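(* Let $0<s\le3$ and write $s=m+\alpha$ with $m=\lceil s\rceil-1$ and $\alpha=s-m\in(0,1]$. Let $(r_n)_{n\ge0}$ be a sequence in $(0,1)$ with $\sup_n r_n<1$. Let $X_n$ ($n\ge0$) and $X$ be $\mathcal{C}[0,1]$-valued random variables with $\|X_n\|_s<\infty$ for all $n\ge 0$ and $\|X\|_s<\infty$. Suppose one of the following conditions is satisfied: (1) $X_n\in\mathcal{C}_{r_n}[0,1]$ for all $n$ and $\zeta_s(X_n,X)=o(\log^{-m}(1/r_n))$ as $n\to\infty$. (2) $X_n=Y_n+h_n$ with $\mathcal{C}[0,1]$-valued random variables $Y_n$ and (deterministic) $h_n\in\mathcal{C}[0,1]$, $n\ge0$, such that $\|h_n-h\|_\infty\to0$ for some $h\in\mathcal{C}[0,1]$, $\mathbf{E}\bigl[\|X_n\|_\infty^s\mathbf{1}_{\{Y_n\notin\mathcal{C}_{r_n}[0,1]\}}\bigr]\to0$, and $\zeta_s(X_n,X)=o(\log^{-m}(1/r_n))$ as $n\to\infty$. (3) $(Y_n)_{n\ge0}$ is a sequence of $\mathcal{C}[0,1]$-valued random variables such that, almost surely, $|Y_n(t)|\le Z(t)$ for all $t\in[0,1]$ and all $n$, for a $\mathcal{C}[0,1]$-valued random variable $Z$ with $\|Z\|_s<\infty$; moreover $X_n\in\mathcal{C}_{r_n}[0,1]$ for all $n$ and $\zeta_s(X_n,Y_n)=o(\log^{-m}(1/r_n))$ as $n\to\infty$. Then the family $\{\|X_n\|_\infty^s\mid n\ge0\}$ is uniformly integrable.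 All statements remain true if $\mathcal{C}[0,1]$ and $\mathcal{C}_{r_n}[0,1]$ are replaced throughout by $\mathcal{D}[0,1]$ and $\mathcal{D}_{r_n}[0,1]$, with $h$ in (2) still required to be continuous.
   Context: $\mathcal{C}[0,1]$ is the space of continuous functions $[0,1]\to\mathbb{R}$ with the norm $\|f\|_\infty=\sup_{t}|f(t)|$ and its Borel $\sigma$-algebra. $\mathcal{D}[0,1]$ is the space of càdlàg functions $[0,1]\to\mathbb{R}$ with the Skorokhod metric $d_{\mathrm{sk}}$ ($d_{\mathrm{sk}}(f,g)$ is the infimum of all $\varepsilon>0$ such that for some increasing bijection $\tau$ of $[0,1]$ one has $|f(t)-g(\tau(t))|<\varepsilon$ and $|\tau(t)-t|<\varepsilon$ for all $t$) and the Borel $\sigma$-algebra of $d_{\mathrm{sk}}$. For a random variable $X$ in either space, $\|X\|_s:=(\mathbf{E}[\|X\|_\infty^s])^{(1/s)\wedge1}$. For $r>0$, $\mathcal{C}_r[0,1]$ is the set of $f\in\mathcal{C}[0,1]$ for which there are $0=t_1<t_2<\dots<t_\ell=1$ with $|t_i-t_{i-1}|\ge r$ and $f|_{[t_{i-1},t_i]}$ linear (affine) for $i=2,\dots,\ell$. $\mathcal{D}_r[0,1]$ is the set of $f\in\mathcal{D}[0,1]$ for which there are $0=t_1<\dots<t_\ell=1$ with $|t_i-t_{i-1}|\ge r$ and $f|_{[t_{i-1},t_i)}$ constant for $i=2,\dots,\ell$, and $f$ continuous at $1$. Zolotarev metric: for $s>0$ put $m=\lceil s\rceil-1$, $\alpha=s-m$.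 With $B=\mathcal{C}[0,1]$ or $\mathcal{D}[0,1]$ (in both cases differentiability is Fréchet differentiability with respect to $\|\cdot\|_\infty$), $\mathcal{F}_s$ is the set of $m$-times continuously differentiable $f:B\to\mathbb{R}$ with $\|D^mf(x)-D^mf(y)\|\le\|x-y\|_\infty^{\alpha}$ for all $x,y\in B$, where the norm of a continuous $m$-linear form $g$ is $\sup_{\|h_i\|_\infty\le1}|g(h_1,\dots,h_m)|$. For $B$-valued random variables $X,Y$, $\zeta_s(X,Y)=\sup_f|\mathbf{E}[f(X)-f(Y)]|$, where the supremum is over $f\in\mathcal{F}_s$ if $B=\mathcal{C}[0,1]$ and over those $f\in\mathcal{F}_s$ that are Borel measurable with respect to $d_{\mathrm{sk}}$ if $B=\mathcal{D}[0,1]$. *)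

(* Defs.v *)
From HB Require Import structures.
From mathcomp Require Import all_boot all_order all_algebra.
From mathcomp Require Import all_classical all_reals all_analysis.

Set Implicit Arguments.
Unset Strict Implicit.
Unset Printing Implicit Defensive.

Import Order.TTheory GRing.Theory Num.Theory.
Import numFieldNormedType.Exports.

Local Open Scope classical_set_scope.
Local Open Scope ring_scope.

Section sup_norm.
Context {R : realType} {T : Type} (A : set T).
Implicit Types f g : T -> R^o.

Definition sup_norm f : R := sup [set `|f t| | t in A].

Definition bounded_on f := exists M, forall t, A t -> `|f t| <= M.

Hypothesis A0 : A !=set0.

Lemma sup_norm_ub f t : bounded_on f -> A t -> `|f t| <= sup_norm f.
Proof.
move=> [M fM] At; apply: ub_le_sup; last by exists t.
by exists M => _ [u Au <-]; exact: fM.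
Qed.

Lemma sup_norm_le f M : (forall t, A t -> `|f t| <= M) -> sup_norm f <= M.
Proof.
move=> fM; apply: ge_sup; first by case: A0 => t At; exists `|f t|, t.
by move=> _ [u Au <-]; exact: fM.
Qed.

Lemma sup_normD f g : bounded_on f -> bounded_on g ->
  sup_norm (f + g) <= sup_norm f + sup_norm g.
Proof.
move=> bf bg; apply: sup_norm_le => t At; apply: (le_trans (ler_normD _ _)).
by apply: lerD; apply: sup_norm_ub.
Qed.

Lemma sup_normZ_le (a : R) f : bounded_on f ->
  sup_norm (a *: f) <= `|a| * sup_norm f.
Proof.
move=> bf; apply: sup_norm_le => t At; rewrite [X in `|X|]/(_ * _) normrM.
by rewrite ler_wpM2l// sup_norm_ub.
Qed.

Lemma sup_normZ (a : R) f : bounded_on f ->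
  sup_norm (a *: f) = `|a| * sup_norm f.
Proof.
move=> bf; apply/eqP; rewrite eq_le sup_normZ_le//=.
have [->|a0] := eqVneq a 0.
  rewrite normr0 mul0r; case: A0 => t At.
  apply: (le_trans (normr_ge0 ((0 *: f) t))).
  by apply: sup_norm_ub => //; exists 0 => u _; rewrite scale0r normr0.
rewrite -ler_pdivlMl ?normr_gt0// -normfV.
rewrite -[X in sup_norm X <= _](scalerK a0); apply: sup_normZ_le.
case: bf => M fM; exists (`|a| * M) => t At.
by rewrite [X in `|X|]/(_ * _) normrM ler_wpM2l// fM.
Qed.

Lemma sup_norm_eq0 f t : bounded_on f -> sup_norm f = 0 -> A t -> f t = 0.
Proof.
move=> bf f0 At; apply/eqP; rewrite -normr_le0 -f0.
exact: sup_norm_ub.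
Qed.

End sup_norm.

Lemma cvg_lincomb {R : realType} {T : Type} (F : set_system T) {FF : Filter F}
    (a : R) (f g : T -> R^o) (l l' : R^o) :
  f @ F --> l -> g @ F --> l' -> (a *: f + g) @ F --> a *: l + l'.
Proof. by move=> fl gl; apply: cvgD gl; apply: cvgM fl; exact: cvg_cst. Qed.

Notation I01 R := (set_type (`[0%R : R, 1%R : R]%classic)).

Section cadlag.
Context {R : realType}.
Implicit Types f : I01 R -> R^o.

(* At [t = 0] (resp. [t = 1]) the left (resp. right) condition is vacuous. *)
Definition cadlag f := forall t : I01 R,
  f @ within (fun u : I01 R => \val t <= \val u) (nbhs t) --> f t /\
  exists l : R^o, f @ within (fun u : I01 R => \val u < \val t) (nbhs t) --> l.

Lemma I01_neq0 : [set: I01 R] !=set0.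
Proof.
have h : (0 : R) \in `[0, 1]%classic by rewrite inE/= in_itv/= lexx ler01.
by exists (exist _ 0 h).
Qed.

Lemma continuous_cadlag f : continuous f -> cadlag f.
Proof.
move=> cf t; split; last exists (f t);
  by apply: cvg_trans (cf t); apply: cvg_app; exact: cvg_within.
Qed.

Lemma cadlag_bounded f : cadlag f -> bounded_on [set: I01 R] f.
Proof.
move=> cf.
have /compact_near_coveringP/near_covering_withinP := @segment_compact R 0 1.
move=> /(_ R +oo (fun M x => forall h : x \in `[0, 1]%classic,
  `|f (exist _ x h)| <= M) _) [].
- move=> x x01; have tx : x \in `[0, 1]%classic by rewrite inE.
  pose t : I01 R := exist _ x tx.
  have [/cvgrPdist_le/(_ 1 ltr01) fr [l /cvgrPdist_le/(_ 1 ltr01) fl]] := cf t.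
  have /nbhs_ballP[e /= e0 He] : \forall u \near t, `|f u| <= `|f t| + `|l| + 1.
    near=> u; have [tu|ut] := leP (\val t) (\val u).
    + have H : `|f t - f u| <= 1 by move: tu; near: u; exact: fr.
      rewrite -[f u](subKr (f t)) (le_trans (ler_normB _ _))// -addrA lerD2l.
      by rewrite (le_trans H)// lerDr.
    + have H : `|l - f u| <= 1 by move: ut; near: u; exact: fl.
      rewrite -[f u](subKr l) (le_trans (ler_normB _ _))// -addrA.
      by rewrite (le_trans _ (lerD (normr_ge0 (f t)) (lexx _)))// add0r lerD2l.
  exists (ball x e, [set M | `|f t| + `|l| + 1 <= M]).
    split; first exact: nbhsx_ballx.
    by exists (`|f t| + `|l| + 1); split; rewrite ?num_real// => M /ltW.
  move=> [y M] /= [yx leM] y01 h.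
  by apply: le_trans leM; apply: He.
- move=> M [_ HM]; exists (M + 1) => t _.
  have := HM (M + 1); rewrite ltrDl => /(_ ltr01 (\val t)).
  by case: t => t ht /= /(_ (set_mem ht) ht).
Unshelve. all: by end_near. Qed.

End cadlag.

Section continuous_functions.
Context {R : realType}.

Definition continuous01 : {pred (I01 R -> R^o)} := fun f => `[< continuous f >].

Record C01 := MkC01 { c01_fun :> I01 R -> R^o ; _ : c01_fun \in continuous01 }.

HB.instance Definition _ := [isSub for c01_fun].
HB.instance Definition _ := [Choice of C01 by <:].

Lemma continuous01_submod : submod_closed continuous01.
Proof.
split; first by apply/asboolP; exact: (@cst_continuous (I01 R) R^o 0).
move=> a f g /asboolP cf /asboolP cg; apply/asboolP => t.
exact: (@cvg_lincomb R _ (nbhs t) _ a f g _ _ (cf t) (cg t)).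
Qed.

HB.instance Definition _ :=
  GRing.isSubmodClosed.Build _ _ continuous01 continuous01_submod.
HB.instance Definition _ := [SubChoice_isSubLmodule of C01 by <:].

Lemma C01_bounded (f : C01) : bounded_on [set: I01 R] f.
Proof. by apply/cadlag_bounded/continuous_cadlag/asboolP; case: f. Qed.

Definition C01_norm (f : C01) : R := sup_norm [set: I01 R] f.

Lemma C01_normD f g : C01_norm (f + g) <= C01_norm f + C01_norm g.
Proof. by apply: sup_normD; [exact: I01_neq0|exact: C01_bounded..]. Qed.

Lemma C01_normZ a f : C01_norm (a *: f) = `|a| * C01_norm f.
Proof. by apply: sup_normZ; [exact: I01_neq0|exact: C01_bounded]. Qed.

Lemma C01_norm_eq0 f : C01_norm f = 0 -> f = 0.
Proof.
move=> f0; apply/val_inj/funext => t.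
exact: (sup_norm_eq0 (@C01_bounded f) f0).
Qed.

HB.instance Definition _ :=
  Lmodule_isNormed.Build R C01 C01_normD C01_normZ C01_norm_eq0.

HB.instance Definition _ :=
  isMeasurable.Build (sigma_display (open : set (set C01))) C01
    (@sigma_algebra0 _ setT open) (@sigma_algebraC _ open)
    (@sigma_algebra_bigcup _ setT open).

End continuous_functions.
Arguments C01 R : clear implicits.

Section cadlag_functions.
Context {R : realType}.

Definition cadlag01 : {pred (I01 R -> R^o)} := fun f => `[< cadlag f >].

Record D01 := MkD01 { d01_fun :> I01 R -> R^o ; _ : d01_fun \in cadlag01 }.

HB.instance Definition _ := [isSub for d01_fun].
HB.instance Definition _ := [Choice of D01 by <:].

Lemma cadlag01_submod : submod_closed cadlag01.
Proof.
split.
  apply/asboolP/continuous_cadlag; exact: (@cst_continuous (I01 R) R^o 0).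
move=> a f g /asboolP cf /asboolP cg; apply/asboolP => t.
have [fr [lf fl]] := cf t; have [gr [lg gl]] := cg t.
split; first exact: (@cvg_lincomb R _ _ _ a f g _ _ fr gr).
by exists (a *: lf + lg); exact: (@cvg_lincomb R _ _ _ a f g _ _ fl gl).
Qed.

HB.instance Definition _ :=
  GRing.isSubmodClosed.Build _ _ cadlag01 cadlag01_submod.
HB.instance Definition _ := [SubChoice_isSubLmodule of D01 by <:].

Lemma D01_bounded (f : D01) : bounded_on [set: I01 R] f.
Proof. by apply/cadlag_bounded/asboolP; case: f. Qed.

Definition D01_norm (f : D01) : R := sup_norm [set: I01 R] f.

Lemma D01_normD f g : D01_norm (f + g) <= D01_norm f + D01_norm g.
Proof. by apply: sup_normD; [exact: I01_neq0|exact: D01_bounded..]. Qed.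

Lemma D01_normZ a f : D01_norm (a *: f) = `|a| * D01_norm f.
Proof. by apply: sup_normZ; [exact: I01_neq0|exact: D01_bounded]. Qed.

Lemma D01_norm_eq0 f : D01_norm f = 0 -> f = 0.
Proof.
move=> f0; apply/val_inj/funext => t.
exact: (sup_norm_eq0 (@D01_bounded f) f0).
Qed.

HB.instance Definition _ :=
  Lmodule_isNormed.Build R D01 D01_normD D01_normZ D01_norm_eq0.

Definition skorokhod_dist (f g : D01) : R :=
  inf [set e | 0 < e /\ exists tau : I01 R -> I01 R,
    [/\ bijective tau,
        forall t u, \val t < \val u -> \val (tau t) < \val (tau u) &
        forall t, `|f t - g (tau t)| < e /\ `|\val (tau t) - \val t| < e]].

Definition skorokhod_open : set (set D01) :=
  [set U | forall f, U f ->
     exists2 e : R, 0 < e & [set g | skorokhod_dist f g < e] `<=` U].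

(* The norm structure of [D01] comes from the sup norm, its measurable structure
   from the (coarser) Skorokhod topology. *)
HB.instance Definition _ :=
  isMeasurable.Build (sigma_display skorokhod_open) D01
    (@sigma_algebra0 _ setT skorokhod_open) (@sigma_algebraC _ skorokhod_open)
    (@sigma_algebra_bigcup _ setT skorokhod_open).

End cadlag_functions.
Arguments D01 R : clear implicits.

Section piecewise.
Context {R : realType}.

Definition C01_piecewise_linear (r : R) : set (C01 R) :=
  [set f | exists (l : nat) (t : nat -> R),
    [/\ t 0%N = 0, t l = 1 &
        forall i, (i < l)%N ->
          [/\ t i < t i.+1, r <= `|t i.+1 - t i| &
              exists a b : R, forall u : I01 R,
                t i <= \val u <= t i.+1 -> f u = a * \val u + b]]].

Definition D01_piecewise_constant (r : R) : set (D01 R) :=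
  [set f |
    [/\ exists (l : nat) (t : nat -> R),
          [/\ t 0%N = 0, t l = 1 &
              forall i, (i < l)%N ->
                [/\ t i < t i.+1, r <= `|t i.+1 - t i| &
                    exists c : R, forall u : I01 R,
                      t i <= \val u < t i.+1 -> f u = c]] &
        forall u : I01 R, \val u = 1 -> {for u, continuous f}]].

End piecewise.

Section multilinear_forms.
Context {R : realType} {B : normedModType R} {k : nat}.

Definition multilinear (g : ('I_k -> B) -> R^o) :=
  forall (i : 'I_k) (h : 'I_k -> B), linear (fun v : B => g (dfwith h i v)).

Definition cmlform_pred : {pred (('I_k -> B) -> R^o)} :=
  fun g => `[< multilinear g /\ continuous (g : {ptws 'I_k -> B} -> R^o) >].

Record cmlform := MkCmlform {
  cmlform_fun :> ('I_k -> B) -> R^o ; _ : cmlform_fun \in cmlform_pred }.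

HB.instance Definition _ := [isSub for cmlform_fun].
HB.instance Definition _ := [Choice of cmlform by <:].

Lemma cmlform_submod : submod_closed cmlform_pred.
Proof.
split.
  apply/asboolP; split; last exact: (@cst_continuous {ptws 'I_k -> B} R^o 0).
  by move=> i h a u v; rewrite /= scaler0 addr0.
move=> a f g /asboolP[lf cf] /asboolP[lg cg]; apply/asboolP; split.
  move=> i h b u v; have := lf i h b u v; have := lg i h b u v => /= gE fE.
  rewrite -[LHS]/(a *: f _ + g _) gE fE -[X in _ = b *: X + _]/(a *: f _ + g _).
  rewrite -[X in _ = _ + X]/(a *: f _ + g _).
  by rewrite !scalerDr !scalerA [b * a]mulrC addrACA.
move=> t; exact: (@cvg_lincomb R _ (nbhs t) _ a f g _ _ (cf t) (cg t)).
Qed.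

HB.instance Definition _ :=
  GRing.isSubmodClosed.Build _ _ cmlform_pred cmlform_submod.
HB.instance Definition _ := [SubChoice_isSubLmodule of cmlform by <:].

Definition unit_arguments : set ('I_k -> B) := [set h | forall i, `|h i| <= 1].

Lemma multilinear_scale (g : ('I_k -> B) -> R^o) (c : R) (h : 'I_k -> B) :
  multilinear g -> g (fun i => c *: h i) = c ^+ k * g h.
Proof.
move=> lg.
have H (s : seq 'I_k) : uniq s ->
    g (fun i => if i \in s then c *: h i else h i) = c ^+ size s * g h.
  elim: s => [_|x s IHs /= /andP[xs us]].
    by rewrite expr0 mul1r; congr g.
  pose H : 'I_k -> B := fun i => if i \in s then c *: h i else h i.
  have -> : (fun i => if i \in x :: s then c *: h i else h i) =
            dfwith H x (c *: h x).
    apply/funext => i; rewrite inE; have [->|ix] := eqVneq i x.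
      by rewrite dfwithin.
    by rewrite dfwithout// eq_sym.
  have /= E0 := lg x H (-1) 0 0; rewrite scaler0 addr0 scaleN1r addNr in E0.
  have /= E := lg x H c (h x) 0; rewrite E0 !addr0 in E.
  rewrite E exprS -mulrA -IHs//; congr (c * g _); apply/funext => i.
  have [->|ix] := eqVneq i x; first by rewrite dfwithin (negPf xs).
  by rewrite dfwithout// eq_sym.
have := H (enum 'I_k) (enum_uniq _); rewrite size_enum_ord => <-.
by congr g; apply/funext => i; rewrite mem_enum.
Qed.

Lemma cmlform_bounded (g : cmlform) : bounded_on unit_arguments g.
Proof.
case: g => g /= /asboolP[lg cg].
pose F : set_system {ptws 'I_k -> B} :=
  filter_from [set e : R | 0 < e] (fun e => [set h | forall i, `|h i| <= e]).
have FF : Filter F.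
  apply: filter_from_filter; first by exists 1 => /=.
  move=> d e /= d0 e0; exists (Num.min d e); first by rewrite /= lt_min d0.
  by move=> h hde; split => i; have := hde i; rewrite le_min => /andP[].
have F0 : F --> ((fun=> 0) : {ptws 'I_k -> B}).
  apply/cvg_sup => i U [V [[W oW <-] W0 WU]].
  have /nbhs_ballP[e /= e0 eW] : nbhs (0 : B) W by exact: open_nbhs_nbhs.
  exists (e / 2); first by rewrite /= divr_gt0.
  move=> h he; apply/WU/eW; rewrite -ball_normE /= sub0r normrN.
  by rewrite (le_lt_trans (he i))// ltr_pdivrMr// ltr_pMr// ltr1n.
have /cvgrPdist_le/(_ 1 ltr01)/F0[e /= e0 He] := cg (fun=> 0).
exists ((`|g (fun=> 0)| + 1) / e ^+ k) => h h1.
rewrite ler_pdivlMr ?exprn_gt0// mulrC -[X in X * _](gtr0_norm (exprn_gt0 k e0)).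
rewrite -normrM -multilinear_scale//.
rewrite -[g (fun i => _)](subKr (g (fun=> 0))) (le_trans (ler_normB _ _))//.
rewrite lerD2l; apply: He => i.
by rewrite normrZ gtr0_norm// ler_piMr// ltW.
Qed.

Let unit_arguments0 : unit_arguments !=set0.
Proof. by exists (fun=> 0) => i; rewrite normr0. Qed.

Definition cmlform_norm (g : cmlform) : R := sup_norm unit_arguments g.

Lemma cmlform_normD f g :
  cmlform_norm (f + g) <= cmlform_norm f + cmlform_norm g.
Proof. by apply: sup_normD => //; exact: cmlform_bounded. Qed.

Lemma cmlform_normZ a f : cmlform_norm (a *: f) = `|a| * cmlform_norm f.
Proof. by apply: sup_normZ => //; exact: cmlform_bounded. Qed.

Lemma cmlform_norm_eq0 f : cmlform_norm f = 0 -> f = 0.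
Proof.
move=> f0; apply/val_inj/funext => h; rewrite -[RHS]/(0 : R).
have [lf _] : multilinear f /\ continuous (f : {ptws 'I_k -> B} -> R^o).
  by apply/asboolP; case: (f).
pose c := (1 + \sum_i `|h i|)^-1.
have c0 : 0 < 1 + \sum_i `|h i| by rewrite ltr_pwDl ?sumr_ge0.
have : c ^+ k * f h = 0.
  rewrite -multilinear_scale//.
  apply: (sup_norm_eq0 (@cmlform_bounded f) f0) => i.
  rewrite normrZ gtr0_norm ?invr_gt0// mulrC ler_pdivrMr// mul1r.
  by rewrite (bigD1 i)//= addrCA lerDl addr_ge0// sumr_ge0.
by move/eqP; rewrite mulf_eq0 expf_eq0 invr_eq0 gt_eqF// andbF => /eqP.
Qed.

HB.instance Definition _ :=
  Lmodule_isNormed.Build R cmlform cmlform_normD cmlform_normZ cmlform_norm_eq0.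

End multilinear_forms.
Arguments cmlform {R} B k.

Section zolotarev.
Context {R : realType}.

(* For [0 < s], [s = zolotarev_order s + holder_exponent s] with
   [0 < holder_exponent s <= 1]. *)
Definition zolotarev_order (s : R) : nat := `|Num.ceil s - 1|%N.

Definition holder_exponent (s : R) : R := s - (zolotarev_order s)%:R.

Definition ord_cons {T : Type} {k : nat} (v : T) (h : 'I_k -> T) : 'I_k.+1 -> T :=
  fun i => oapp h v (unlift ord0 i).

(* [D k] is the [k]-th Frechet derivative of [f] for [k <= m], where the iterated
   derivative in the space of continuous linear maps into [cmlform B k] is read
   as an element of [cmlform B k.+1]; nothing is said about [D k] for [k > m]. *)
Definition frechet_derivatives {B : normedModType R} (m : nat) (f : B -> R)
    (D : forall k : nat, B -> cmlform B k) : Prop :=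
  (forall x h, D 0%N x h = f x) /\
  (forall k, (k < m)%N -> forall x : B, differentiable (D k) x /\
     forall v h, 'd (D k) x v h = D k.+1 x (ord_cons v h)).

Definition zolotarev_class (B : normedModType R) (s : R) : set (B -> R) :=
  [set f | exists D : forall k : nat, B -> cmlform B k,
    let m := zolotarev_order s in
    [/\ frechet_derivatives m f D, continuous (D m) &
        forall x y, `|D m x - D m y| <= `|x - y| `^ holder_exponent s]].

Context {d : measure_display} {Omega : measurableType d} (P : probability Omega R).

Definition zolotarev_dist {B : Type} (F : set (B -> R)) (X Y : Omega -> B) : \bar R :=
  ereal_sup [set `|'E_P[(fun w => f (X w) - f (Y w))%R]|%E | f in F].

Definition C01_zeta (s : R) (X Y : Omega -> C01 R) : \bar R :=
  zolotarev_dist (@zolotarev_class (C01 R) s) X Y.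

Definition D01_zeta (s : R) (X Y : Omega -> D01 R) : \bar R :=
  zolotarev_dist
    (@zolotarev_class (D01 R) s `&` [set f | measurable_fun [set: D01 R] f]) X Y.

Definition snorm {B : normedModType R} (s : R) (X : Omega -> B) : \bar R :=
  ((\int[P]_w (`|X w| `^ s)%R%:E) `^ (Num.min s^-1 1)%R)%E.

Definition uniformly_integrable {I : Type} (F : I -> Omega -> R) : Prop :=
  ereal_sup
    [set (\int[P]_(w in [set w | (K < `|F i w|)%R]) `|F i w|%R%:E)%E | i in [set: I]]
    @[K --> +oo%R] --> 0%E.

End zolotarev.

(* [a_ n = o(b_ n)] for extended real [a_], which may be infinite for finitely
   many [n]. *)
Definition ereal_littleo {R : realType} (a_ : nat -> \bar R) (b_ : nat -> R) : Prop :=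
  forall e : R, 0 < e -> \forall n \near \oo, (`|a_ n| <= (e * `|b_ n|)%:E)%E.

(* Main.v *)
(* Test functions only need to see x at the 2^p points of a dyadic grid that is
   four times finer than r: there a piecewise linear (or constant) x attains at
   least half of its sup norm. So take
     f_K x = (K^p + sum_j x(t_j)^p)^(s/p),   p even, p of order log(1/r).
   As the number 2^p of grid points is absorbed by p-th roots, f_K - K^s is
   bounded by (2 |x|)^s and by (2 |x|)^4 / K, uniformly in p, while it exceeds
   (|x| / 4)^s / 2 once |x| is large compared with K and the grid sees |x|.
   With w = (K^p + sum_j x(t_j)^p)^(1/p) the i-th derivative of f_K is
   O(p^(i-1) w^(s-i)) for i = 1, 2, 3, and w is Lipschitz, so D^m f_K is
   alpha-Hoelder with constant O(p^m): this is where log^m(1/r) comes from.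
   Hence the tails of |X_n|^s are at most O(1) times
   E[f_K(X) - K^s] + O(p_n^m) zeta_s(X_n, X); the first term is small for large
   K by dominated convergence, the second one for large n by assumption. *)
Require Import Defs.
From HB Require Import structures.
From mathcomp Require Import all_boot all_order all_algebra.
From mathcomp Require Import all_classical all_reals all_analysis.
From mathcomp Require Import measurable_realfun ring lra.
Import Order.TTheory GRing.Theory Num.Theory.
Import numFieldNormedType.Exports.
Local Open Scope classical_set_scope.
Local Open Scope ring_scope.

(** The sup norm is not differentiable, whereas a sum of even powers of coordinates is a polynomial.
    The summand K^p keeps this polynomial away from 0, so that its power s/p is smooth everywhere,
    the origin included, and nearly constant on any ball once K is large. The grid must have at
    least 4/r points if it is to see functions with pieces of length r; as it may have only 2^p
    points, p cannot stay bounded when r tends to 0. Since s <= 3 means m <= 2, three derivatives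
    are enough. All this is done in an arbitrary normed space with finitely many linear functionals
    of norm at most 1. C[0,1] and D[0,1] then differ only in how evaluations on the grid detect the
    norm and in why they are measurable. The latter is delicate on D[0,1], where evaluation at an
    interior point is not continuous for the Skorokhod metric. *)

(** * Derivatives of sums, real powers and power sums of linear functionals *)

Lemma is_diff_sum (R : numFieldType) (V W : normedModType R) (I : Type)
    (l : seq I) (f df : I -> V -> W) (x : V) :
  (forall i, is_diff x (f i) (df i)) ->
  is_diff x (\sum_(i <- l) f i) (\sum_(i <- l) df i).
Proof.
move=> fE; elim: l => [|i l IHl].
  rewrite !big_nil; exact: (is_diff_cst (0 : W) x).
by rewrite !big_cons; exact: is_diffD.
Qed.

Lemma is_diff_powR (R : realType) (V : normedModType R) (f df : V -> R) (x : V)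
    (c : R) : is_diff x f df -> 0 < f x ->
  is_diff x (fun y => f y `^ c) (fun v => c * f x `^ (c - 1) * df v).
Proof.
move=> dfx fx0.
have h := @is_derive1_powR R c _ fx0.
pose g : R -> R := @powR R ^~ c.
have dp : differentiable g (f x) by apply/derivable1_diffP.
have idp := differentiableP dp.
have gfE := @is_diff_comp _ _ _ _ f df g ('d g (f x)) x dfx idp.
apply: is_diff_eq gfE _.
apply/funext => v /=.
by rewrite (diff1E dp) derive1E (@derive_val _ _ _ _ _ _ _ h) /= -[LHS]/(_ * _) mulrC.
Qed.

Section cylinder.
Context {R : realType} {B : normedModType R} {N : nat}.
Variable e : 'I_N -> {linear B -> R^o}.
Hypothesis e_le : forall j x, `|e j x| <= `|x|.

Lemma is_diff_coord j x : is_diff x (e j : B -> R) (e j : B -> R).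
Proof.
have ec : continuous (e j).
  apply: bounded_linear_continuous; apply/linear_boundedP.
  near=> r => y; apply: (le_trans (e_le _ _)).
  by rewrite ler_peMl//; near: r; exact: nbhs_pinfty_ge.
by apply: DiffDef; [exact: linear_differentiable|exact: diff_lin].
Unshelve. all: by end_near. Qed.

(** The weights [w] make the family closed under differentiation: a derivative in direction [v]
    lowers the power and multiplies [w j] by [e j v]. *)
Definition power_sum (i : nat) (x : B) (w : 'I_N -> R) : R :=
  \sum_j e j x ^+ i * w j.

Lemma is_diff_power_sum i x w :
  is_diff x (fun y => power_sum i.+1 y w)
    (fun v => i.+1%:R * power_sum i x (fun j => w j * e j v)).
Proof.
rewrite (_ : (fun y => _) = \sum_j (w j *: (e j : B -> R) ^+ i.+1)); last first.
  apply/funext => y; rewrite fct_sumE; apply: eq_bigr => j _.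
  by rewrite -[RHS]/(w j * ((e j : B -> R) ^+ i.+1) y) exprfctE mulrC.
have dE j : is_diff x (w j *: (e j : B -> R) ^+ i.+1)
    (w j *: (i.+1%:R * e j x ^+ i *: (e j : B -> R))).
  have d1 := is_diff_coord j x.
  have d2 := @is_diffX R B (e j) (e j) i x d1.
  exact: (is_diffZ (w j) d2).
have sE := is_diff_sum R B R _ (index_enum 'I_N) _ _ x dE.
apply: is_diff_eq sE _.
apply/funext => v; rewrite fct_sumE mulr_sumr; apply: eq_bigr => j _.
rewrite -[LHS]/(w j * (i.+1%:R * e j x ^+ i * e j v)); ring.
Qed.

End cylinder.

(** * The smooth norm and its derivatives *)

Lemma is_diff_mulr (R : realType) (V : normedModType R) (f df g dg : V -> R)
    (x : V) : is_diff x f df -> is_diff x g dg ->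
  is_diff x (fun y => f y * g y) (fun v => df v * g x + f x * dg v).
Proof.
move=> dfx dgx; have H := @is_diffM R V f g df dg x dfx dgx.
apply: is_diff_eq H _; apply/funext => v.
by rewrite -[LHS]/(f x * dg v + g x * df v) addrC [g x * _]mulrC.
Qed.

Lemma is_diff_addr (R : realType) (V : normedModType R) (f df g dg : V -> R)
    (x : V) : is_diff x f df -> is_diff x g dg ->
  is_diff x (fun y => f y + g y) (fun v => df v + dg v).
Proof. by move=> dfx dgx; exact: (@is_diffD R V R f g df dg x dfx dgx). Qed.

Lemma is_diff_scale (R : realType) (V : normedModType R) (c : R) (f df : V -> R)
    (x : V) : is_diff x f df ->
  is_diff x (fun y => c * f y) (fun v => c * df v).
Proof. by move=> dfx; exact: (@is_diffZ R V R f df c x dfx). Qed.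

Lemma is_diff_line (R : realType) (V : normedModType R) (f df : V -> R)
    (x v : V) (u : R) : is_diff (x + u *: v) f df ->
  is_derive u 1 (fun t => f (x + t *: v)) (df v).
Proof.
move=> dfx; have dv := deriveE v (@ex_diff _ _ _ _ _ _ _ dfx).
have := @diff_derivable _ _ _ f (x + u *: v) v (@ex_diff _ _ _ _ _ _ _ dfx).
rewrite (@diff_val _ _ _ _ _ _ _ dfx) in dv.
have E : (fun h : R =>
    h^-1 *: (((fun t => f (x + t *: v)) \o shift u) (h *: 1) - f (x + u *: v))) =
  (fun h : R => h^-1 *: ((f \o shift (x + u *: v)) (h *: v) - f (x + u *: v))).
  apply/funext => h /=; congr (_ *: (f _ - _)).
  rewrite -[h *: 1]/(h * 1) mulr1 scalerDl; exact: addrCA.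
by split; [rewrite /derivable E|rewrite /derive E].
Qed.

Lemma MVT_line (R : realType) (V : normedModType R) (f : V -> R)
    (df : V -> V -> R) (x y : V) : (forall z, is_diff z f (df z)) ->
  exists2 u : R, 0 <= u <= 1 & f y - f x = df (x + u *: (y - x)) (y - x).
Proof.
move=> dfE; pose g (t : R) := f (x + t *: (y - x)).
have dg (u : R) : is_derive u (1 : R) g (df (x + u *: (y - x)) (y - x)).
  exact: is_diff_line.
have [||u] := @MVT_segment R g (fun u => df (x + u *: (y - x)) (y - x)) 0 1.
- exact: ler01.
- apply: continuous_subspaceT => u; apply: differentiable_continuous.
  by apply/derivable1_diffP; case: (dg u).
- rewrite in_itv/= => u01; rewrite subr0 mulr1 /g scale1r scale0r addr0 subrKC.
  by exists u.
Qed.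

Section power.
Context {R : realType} {B : normedModType R} {N : nat}.
Variable e : 'I_N -> {linear B -> R^o}.
Hypothesis e_le : forall j x, `|e j x| <= `|x|.
Variables (k : nat) (K s : R).
Hypotheses (k_even : ~~ odd k) (K_gt0 : 0 < K).

Local Notation p := (k.+4%:R : R).
Local Notation ps := (power_sum e).

(** The term [K ^+ k.+4] makes the gauge positive, so all its real powers are differentiable, also
    where every coordinate vanishes. *)
Definition gauge (x : B) : R := K ^+ k.+4 + ps k.+4 x (fun=> 1).

Lemma power_sum_even_ge0 i x : ~~ odd i -> 0 <= ps i x (fun=> 1).
Proof. by move=> ie; apply: sumr_ge0 => j _; rewrite mulr1 exprn_even_ge0. Qed.

Lemma gauge_gt0 x : 0 < gauge x.
Proof.
rewrite ltr_pwDl ?exprn_gt0//; apply: power_sum_even_ge0.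
by rewrite !oddS !negbK.
Qed.

Lemma is_diff_gauge_powR x c :
  is_diff x (fun y => gauge y `^ c)
    (fun v => c * p * gauge x `^ (c - 1) * ps k.+3 x (fun j => e j v)).
Proof.
have dG : is_diff x gauge (fun v => p * ps k.+3 x (fun j => e j v)).
  have := is_diff_addr _ _ _ _ _ _ _ (is_diff_cst (K ^+ k.+4 : R) x)
    (is_diff_power_sum e e_le k.+3 x (fun=> 1)).
  move=> H; apply: is_diff_eq H _; apply/funext => v.
  rewrite -[LHS]/(0 + _) add0r; congr (_ * power_sum e _ _ _).
  by apply/funext => j; rewrite mul1r.
have H := is_diff_powR _ _ _ _ _ c dG (gauge_gt0 x).
by apply: is_diff_eq H _; apply/funext => v; ring.
Qed.

Definition smooth_norm x := gauge x `^ (s / p).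

(** The derivatives are functions of coordinate vectors [h]; a direction [v] enters as
    [fun j => e j v]. This admits unit coordinate vectors, which need not come from any vector of
    [B]. *)
Definition smooth_norm_d1 x (h : 'I_N -> R) := s * (gauge x `^ (s / p - 1) * ps
  k.+3 x h).

Definition smooth_norm_d2 x (h g : 'I_N -> R) :=
  s * (p - 1) * (gauge x `^ (s / p - 1) * ps k.+2 x (fun j => h j * g j)) +
  s * (s - p) * (gauge x `^ (s / p - 2) * (ps k.+3 x h * ps k.+3 x g)).

(** The coefficient s (p - 1) (s - p) has two sources: the power of the gauge in the first term of
    [smooth_norm_d2], and the two power sums in its second term. Together they give the three
    symmetric products. *)
Definition smooth_norm_d3 x (h g v : 'I_N -> R) :=
  s * (p - 1) * (p - 2) *
    (gauge x `^ (s / p - 1) * ps k.+1 x (fun j => h j * g j * v j)) +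
  s * (p - 1) * (s - p) *
    (gauge x `^ (s / p - 2) *
      (ps k.+3 x v * ps k.+2 x (fun j => h j * g j) +
       ps k.+3 x g * ps k.+2 x (fun j => h j * v j) +
       ps k.+3 x h * ps k.+2 x (fun j => g j * v j))) +
  s * (s - p) * (s - 2 * p) *
    (gauge x `^ (s / p - 3) * (ps k.+3 x h * ps k.+3 x g * ps k.+3 x v)).

Let p_neq0 : p != 0. Proof. by rewrite pnatr_eq0. Qed.

Lemma is_diff_smooth_norm x : is_diff x smooth_norm (fun v => smooth_norm_d1 x
  (fun j => e j v)).
Proof.
apply: is_diff_eq (is_diff_gauge_powR x (s / p)) _; apply/funext => v.
rewrite /smooth_norm_d1 !mulrA divfK//.
Qed.

Lemma is_diff_smooth_norm_d1 x h : is_diff x (smooth_norm_d1 ^~ h) (fun v =>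
  smooth_norm_d2 x h (fun j => e j v)).
Proof.
have H := is_diff_scale _ _ s _ _ _ (is_diff_mulr _ _ _ _ _ _ _
  (is_diff_gauge_powR x (s / p - 1)) (is_diff_power_sum e e_le k.+2 x h)).
apply: is_diff_eq H _; apply/funext => v.
rewrite /smooth_norm_d2 (_ : s / p - 1 - 1 = s / p - 2); last by ring.
rewrite (_ : (s / p - 1) * p = s - p); last by field.
rewrite (_ : k.+3%:R = p - 1 :> R); last by rewrite -(natr1 k.+3) addrK.
ring.
Qed.

Lemma is_diff_smooth_norm_d2 x h g : is_diff x (fun y => smooth_norm_d2 y h g)
  (fun v => smooth_norm_d3 x h g (fun j => e j v)).
Proof.
have H := is_diff_addr _ _ _ _ _ _ _
  (is_diff_scale _ _ (s * (p - 1)) _ _ _ (is_diff_mulr _ _ _ _ _ _ _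
    (is_diff_gauge_powR x (s / p - 1))
    (is_diff_power_sum e e_le k.+1 x (fun j => h j * g j))))
  (is_diff_scale _ _ (s * (s - p)) _ _ _ (is_diff_mulr _ _ _ _ _ _ _
    (is_diff_gauge_powR x (s / p - 2))
    (is_diff_mulr _ _ _ _ _ _ _ (is_diff_power_sum e e_le k.+2 x h)
      (is_diff_power_sum e e_le k.+2 x g)))).
apply: is_diff_eq H _; apply/funext => v.
rewrite /smooth_norm_d3 (_ : s / p - 1 - 1 = s / p - 2); last by ring.
rewrite (_ : s / p - 2 - 1 = s / p - 3); last by ring.
rewrite (_ : (s / p - 1) * p = s - p); last by field.
rewrite (_ : (s / p - 2) * p = s - 2 * p); last by field.
rewrite (_ : k.+3%:R = p - 1 :> R); last by rewrite -(natr1 k.+3) addrK.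
rewrite (_ : k.+2%:R = p - 2 :> R); last by rewrite -(natr1 k.+3) -(natr1 k.+2); ring.
ring.
Qed.

End power.

Lemma ler_normM2 (R : realDomainType) (a b A C : R) :
  `|a| <= A -> `|b| <= C -> `|a * b| <= A * C.
Proof. by move=> aA bC; rewrite normrM ler_pM. Qed.

Lemma ler_normD2 (R : realDomainType) (a b A C : R) :
  `|a| <= A -> `|b| <= C -> `|a + b| <= A + C.
Proof. by move=> aA bC; rewrite (le_trans (ler_normD _ _))// lerD. Qed.

(* Far from the origin, relative to |x - y|, the mean value theorem applies;
   close to it, the growth bound alone suffices. *)
Lemma holder_of_growth (R : realType) (V : normedModType R) (w : V -> R)
    (f : V -> R) (df : V -> V -> R) (A a : R) :
  0 < a <= 1 -> 0 <= A -> (forall z, 0 < w z) ->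
  (forall x y, `|w x - w y| <= 4 * `|x - y|) ->
  (forall z, is_diff z f (df z)) ->
  (forall z, `|f z| <= A * w z `^ a) ->
  (forall z v, `|df z v| <= A * w z `^ (a - 1) * `|v|) ->
  forall x y, `|f x - f y| <= 16 * A * `|x - y| `^ a.
Proof.
move=> /andP[a0 a1] A0 w0 wlip fE fle dfle.
have far x y : 8 * `|x - y| < w x -> `|f x - f y| <= 16 * A * `|x - y| `^ a.
  move=> xy; have [xy0|xyN0] := eqVneq x y.
    by rewrite xy0 subrr normr0 !mulr_ge0// powR_ge0.
  have d0 : 0 < `|x - y| by rewrite normr_gt0 subr_eq0.
  have [u /andP[u0 u1] ->] := MVT_line _ _ f df y x fE.
  (* Along the segment [w] drops by at most 4 |x - y| from a value above 8 |x - y|. As a - 1 <= 0, a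
     lower bound on [w z] bounds its power from above. *)
  set z := y + _; have wz : `|x - y| <= w z.
    have : `|x - z| <= `|x - y|.
      rewrite (_ : x - z = (1 - u) *: (x - y)); last first.
        by rewrite scalerBl scale1r /z opprD addrA.
      by rewrite normrZ ger0_norm ?subr_ge0// ler_piMl// gerBl.
    have := wlip x z; have := ler_norm (w x - w z); lra.
  apply: (le_trans (dfle _ _)).
  rewrite -(mulr_powRB1 (normr_ge0 (x - y)) a0).
  apply: (@le_trans _ _ (A * `|x - y| `^ (a - 1) * `|x - y|)).
    rewrite ler_wpM2r// ler_wpM2l// -[a - 1]opprB !powRN.
    rewrite lef_pV2 ?posrE ?powR_gt0//.
    by rewrite ge0_ler_powR ?nnegrE ?subr_ge0// ltW.
  have : 0 <= A * `|x - y| `^ (a - 1) * `|x - y| by rewrite !mulr_ge0 ?powR_ge0.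
  rewrite -mulrA; lra.
move=> x y; have [wx|/far//] := leP (w x) (8 * `|x - y|).
have [wy|] := leP (w y) (8 * `|x - y|); last first.
  by rewrite [`|x - y|]distrC [`|f x - f y|]distrC; exact: far.
(* Here 8^a <= 8; the terms for [x] and [y] add up to the constant 16. *)
have wle z : w z <= 8 * `|x - y| -> `|f z| <= A * (8 * `|x - y| `^ a).
  move=> wz; apply: (le_trans (fle z)); apply: ler_wpM2l => //.
  apply: (@le_trans _ _ ((8 * `|x - y|) `^ a)).
    by rewrite ge0_ler_powR ?nnegrE ?mulr_ge0// ?ltW.
  rewrite powRM// ler_wpM2r ?powR_ge0//.
  by rewrite ler1_powR// ler1n.
apply: (le_trans (ler_normB _ _)).
by have := wle x wx; have := wle y wy; lra.
Qed.

(** * Growth of the derivatives *)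

Section bounds.
Context {R : realType} {B : normedModType R} {N : nat}.
Variable e : 'I_N -> {linear B -> R^o}.
Hypothesis e_le : forall j x, `|e j x| <= `|x|.
Variables (k : nat) (K s : R).
Hypotheses (k_even : ~~ odd k) (K_gt0 : 0 < K) (s_gt0 : 0 < s) (s_le3 : s <= 3).
Hypothesis N_le : N%:R <= 2 ^+ k.+4 :> R.

Local Notation p := (k.+4%:R : R).
Local Notation ps := (power_sum e).
Local Notation G := (gauge e k K).

(** The w of the overview. Since N <= 2^p, it agrees up to a factor 3 with the maximum of K and all
    |e_j x|. *)
Definition gauge_root (x : B) : R := G x `^ p^-1.

Local Notation W := gauge_root.

Let p_ge4 : 4 <= p. Proof. by rewrite ler_nat. Qed.
Let p_neq0 : p != 0. Proof. by rewrite pnatr_eq0. Qed.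

Let p_even : ~~ odd k.+4. Proof. by rewrite !oddS !negbK. Qed.

Let G_gt0 x : 0 < G x.
Proof. exact: gauge_gt0. Qed.

Lemma gauge_root_gt0 x : 0 < W x.
Proof. exact/powR_gt0/G_gt0. Qed.

Lemma gauge_root_powR x a : G x `^ (a / p) = W x `^ a.
Proof. by rewrite /W -powRrM mulrC. Qed.

Lemma gauge_rootX x : W x ^+ k.+4 = G x.
Proof.
by rewrite -powR_mulrn ?ltW ?gauge_root_gt0// -gauge_root_powR divff// powRr1// ltW.
Qed.

(** Normal form for the terms of the derivatives: a term with i power sums carries the i-th inverse
    power of the gauge, so each power sum can be divided by one gauge and estimated separately. *)
Lemma gauge_powRB x a i : G x `^ (a / p - i%:R) = W x `^ a / G x ^+ i.
Proof.
rewrite powRB ?gauge_root_powR; last by rewrite (gt_eqF (G_gt0 x)) implybT.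
by rewrite powR_mulrn// ltW.
Qed.

(* Young's inequality |a|^(p-i) V^i <= |a|^p + V^p with V = W / 2, for which
   N V^p <= W^p. *)
Lemma abs_power_sum_le i x w (c : R) : (i <= k.+4)%N -> 0 <= c -> (forall j,
  `|w j| <= c) ->
  `|ps (k.+4 - i) x w / G x| <= 2 ^+ i.+1 * c / W x ^+ i.
Proof.
move=> ik c0 wc; have W0 := gauge_root_gt0 x.
  rewrite normrM normfV (gtr0_norm (G_gt0 x)) ler_pdivrMr//.
  rewrite [X in _ <= X]mulrAC ler_pdivlMr ?exprn_gt0//.
  pose V := W x / 2; have V0 : 0 < V by rewrite divr_gt0.
  have H j : `|e j x ^+ (k.+4 - i) * w j| * V ^+ i <=
      c * (e j x ^+ k.+4 * 1 + V ^+ k.+4).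
    rewrite normrM mulrAC mulrC mulr1; apply: ler_pM => //.
      by rewrite mulr_ge0// exprn_ge0// ltW.
    have -> : e j x ^+ k.+4 = `|e j x| ^+ k.+4.
      by rewrite -normrX ger0_norm// exprn_even_ge0.
    rewrite normrX -[k.+4 in X in _ <= X](subnK ik) !exprD.
    have [eV|Ve] := leP `|e j x| V.
      rewrite ler_wpDl ?mulr_ge0 ?exprn_ge0//.
      by rewrite ler_wpM2r ?exprn_ge0 ?(ltW V0)// lerXn2r ?nnegrE ?(ltW V0).
    rewrite ler_wpDr ?mulr_ge0 ?exprn_ge0 ?(ltW V0)//.
    by rewrite ler_wpM2l ?exprn_ge0// lerXn2r ?nnegrE// ltW.
  (* Each of the two sums is at most [G x], hence the 2; the other factor [2 ^+ i] of the claim is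
     the price of V = W / 2. *)
  have {H} : `|ps (k.+4 - i) x w| * V ^+ i <= c * (2 * G x).
    apply: (@le_trans _ _ (\sum_j c * (e j x ^+ k.+4 * 1 + V ^+ k.+4))).
      apply: (le_trans _ (ler_sum _ (fun j _ => H j))).
      by rewrite -mulr_suml ler_wpM2r ?exprn_ge0 ?(ltW V0)// ler_norm_sum.
    rewrite -mulr_sumr big_split/= ler_wpM2l// [2 * _]mulrDl mul1r lerD//.
      by rewrite /gauge lerDr exprn_ge0 // ltW.
    rewrite sumr_const card_ord -mulr_natl /V expr_div_n gauge_rootX.
    by rewrite mulrCA ler_piMr ?(ltW (G_gt0 x))// ler_pdivrMr ?exprn_gt0 ?mul1r.
  rewrite /V expr_div_n [_ * (_ / _)]mulrA ler_pdivrMr ?exprn_gt0// => H.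
  by apply: (le_trans H); rewrite exprS le_eqVlt; apply/orP; left; apply/eqP; ring.
Qed.

Let T1 x w (c : R) : 0 <= c -> (forall j, `|w j| <= c) ->
  `|ps k.+3 x w / G x| <= 4 * c / W x.
Proof.
move=> c0 wc; have := abs_power_sum_le 1 x w c isT c0 wc.
by rewrite expr1 (_ : 2 ^+ 2 = 4)//; ring.
Qed.

Let T2 x w (c : R) : 0 <= c -> (forall j, `|w j| <= c) ->
  `|ps k.+2 x w / G x| <= 8 * c / W x ^+ 2.
Proof.
move=> c0 wc; have := abs_power_sum_le 2 x w c isT c0 wc.
by rewrite (_ : 2 ^+ 3 = 8)//; ring.
Qed.

Let T3 x w (c : R) : 0 <= c -> (forall j, `|w j| <= c) ->
  `|ps k.+1 x w / G x| <= 16 * c / W x ^+ 3.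
Proof.
move=> c0 wc; have := abs_power_sum_le 3 x w c isT c0 wc.
by rewrite (_ : 2 ^+ 4 = 16)//; ring.
Qed.

(** The factor p from differentiating p-th powers cancels the exponent 1/p of the root. What remains
    is [W z] times a normalised power sum, which [T1] bounds by 4 |v| / W z, so the constant depends
    neither on p nor on N. *)
Lemma gauge_root_lipschitz x y : `|W x - W y| <= 4 * `|x - y|.
Proof.
have [u _ ->] := MVT_line _ _ _ _ y x
  (fun z => is_diff_gauge_powR e e_le k K k_even K_gt0 z p^-1).
set z := y + _; set v := x - y.
rewrite mulVf// mul1r -[p^-1]mul1r -[_ - 1]/(1 / p - 1%:R) gauge_powRB expr1.
rewrite powRr1 ?(ltW (gauge_root_gt0 _))//.
rewrite mulrAC -mulrA normrM (gtr0_norm (gauge_root_gt0 _)).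
have := T1 z (fun j => e j v) `|v| (normr_ge0 _) (fun j => e_le j v).
by rewrite ler_pdivlMr ?gauge_root_gt0// [_ * W z]mulrC.
Qed.

Lemma smooth_normE x : smooth_norm e k K s x = W x `^ s.
Proof. exact: gauge_root_powR. Qed.

Let s_abs : `|s| <= 3. Proof. by rewrite gtr0_norm. Qed.

(** No factor p appears, because (s/p) p = s; the constant is 12 = 3 * 4. *)
Lemma smooth_norm_d1_le x h (c : R) : 0 <= c -> (forall j, `|h j| <= c) ->
  `|smooth_norm_d1 e k K s x h| <= 12 * c * (W x `^ s / W x).
Proof.
move=> c0 hc; rewrite /smooth_norm_d1 -[1]/(1%:R) gauge_powRB expr1.
rewrite -mulrA [_^-1 * _]mulrC mulrCA normrM (ger0_norm (powR_ge0 _ _)).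
rewrite [X in _ <= X]mulrCA ler_wpM2l ?powR_ge0//.
have H := ler_normM2 _ _ _ _ _ s_abs (T1 x h c c0 hc).
apply: (le_trans H); rewrite le_eqVlt; apply/orP; left; apply/eqP; field.
by rewrite gt_eqF ?gauge_root_gt0.
Qed.

Let sp_abs : `|s - p| <= p.
Proof. by rewrite ler_norml; have := p_ge4; move: s_gt0 s_le3; lra. Qed.
Let s2p_abs : `|s - 2 * p| <= 2 * p.
Proof. by rewrite ler_norml; have := p_ge4; move: s_gt0 s_le3; lra. Qed.
Let p1_abs : `|p - 1| <= p.
Proof. by rewrite ler_norml; have := p_ge4; lra. Qed.
Let p2_abs : `|p - 2| <= p.
Proof. by rewrite ler_norml; have := p_ge4; lra. Qed.

Let mul_le (h g : 'I_N -> R) (c c' : R) :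
  (forall j, `|h j| <= c) -> (forall j, `|g j| <= c') ->
  forall j, `|h j * g j| <= c * c'.
Proof. by move=> hc gc j; exact: ler_normM2. Qed.

(** Both p - 1 and s - p are at most p in absolute value, and 72 = 3 (8 + 4^2) collects one
    second-order term and a product of two first-order ones. *)
Lemma smooth_norm_d2_le x h g (c c' : R) : 0 <= c -> 0 <= c' ->
  (forall j, `|h j| <= c) -> (forall j, `|g j| <= c') ->
  `|smooth_norm_d2 e k K s x h g| <= 72 * p * (c * c') * (W x `^ s / W x ^+ 2).
Proof.
move=> c0 c0' hc gc.
have W0 : W x != 0 by rewrite gt_eqF ?gauge_root_gt0.
have G0 : G x != 0 by rewrite gt_eqF.
rewrite /smooth_norm_d2 (gauge_powRB x s 1) (gauge_powRB x s 2) expr1.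
rewrite (_ : _ + _ = W x `^ s * (s * (p - 1) * (ps k.+2 x (fun j => h j * g j) / G x) +
  s * (s - p) * ((ps k.+3 x h / G x) * (ps k.+3 x g / G x)))); last by field.
rewrite normrM (ger0_norm (powR_ge0 _ _)) [X in _ <= X]mulrCA ler_wpM2l ?powR_ge0//.
have t2 := T2 x _ _ (mulr_ge0 c0 c0') (mul_le _ _ _ _ hc gc).
have t1 := ler_normM2 _ _ _ _ _ (T1 x h c c0 hc) (T1 x g c' c0' gc).
have H := ler_normD2 _ _ _ _ _
  (ler_normM2 _ _ _ _ _ (ler_normM2 _ _ _ _ _ s_abs p1_abs) t2)
  (ler_normM2 _ _ _ _ _ (ler_normM2 _ _ _ _ _ s_abs sp_abs) t1).
by apply: (le_trans H); rewrite le_eqVlt; apply/orP; left; apply/eqP; field.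
Qed.

(** The constant is 720 = 3 (16 + 3 * 4 * 8 + 2 * 4^3), the last 2 coming from |s - 2p| <= 2p. *)
Lemma smooth_norm_d3_le x h g v (c c' c'' : R) : 0 <= c -> 0 <= c' -> 0 <= c'' ->
  (forall j, `|h j| <= c) -> (forall j, `|g j| <= c') ->
  (forall j, `|v j| <= c'') ->
  `|smooth_norm_d3 e k K s x h g v| <=
    720 * p ^+ 2 * (c * c' * c'') * (W x `^ s / W x ^+ 3).
Proof.
move=> c0 c0' c0'' hc gc vc.
have W0 : W x != 0 by rewrite gt_eqF ?gauge_root_gt0.
have G0 : G x != 0 by rewrite gt_eqF.
rewrite /smooth_norm_d3 (gauge_powRB x s 1) (gauge_powRB x s 2) (gauge_powRB x
  s 3) expr1.
rewrite (_ : _ + _ = W x `^ s * (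
  s * (p - 1) * (p - 2) * (ps k.+1 x (fun j => h j * g j * v j) / G x) +
  s * (p - 1) * (s - p) *
   ((ps k.+3 x v / G x) * (ps k.+2 x (fun j => h j * g j) / G x) +
    (ps k.+3 x g / G x) * (ps k.+2 x (fun j => h j * v j) / G x) +
    (ps k.+3 x h / G x) * (ps k.+2 x (fun j => g j * v j) / G x)) +
  s * (s - p) * (s - 2 * p) *
   ((ps k.+3 x h / G x) * (ps k.+3 x g / G x) * (ps k.+3 x v / G x))));
  last by field.
rewrite normrM (ger0_norm (powR_ge0 _ _)) [X in _ <= X]mulrCA ler_wpM2l ?powR_ge0//.
have th := T1 x h c c0 hc.
have tg := T1 x g c' c0' gc.
have tv := T1 x v c'' c0'' vc.
have thg := T2 x _ _ (mulr_ge0 c0 c0') (mul_le _ _ _ _ hc gc).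
have thv := T2 x _ _ (mulr_ge0 c0 c0'') (mul_le _ _ _ _ hc vc).
have tgv := T2 x _ _ (mulr_ge0 c0' c0'') (mul_le _ _ _ _ gc vc).
have thgv := T3 x _ _ (mulr_ge0 (mulr_ge0 c0 c0') c0'')
  (mul_le _ _ _ _ (mul_le _ _ _ _ hc gc) vc).
have H := ler_normD2 _ _ _ _ _ (ler_normD2 _ _ _ _ _
  (ler_normM2 _ _ _ _ _ (ler_normM2 _ _ _ _ _
    (ler_normM2 _ _ _ _ _ s_abs p1_abs) p2_abs) thgv)
  (ler_normM2 _ _ _ _ _ (ler_normM2 _ _ _ _ _
    (ler_normM2 _ _ _ _ _ s_abs p1_abs) sp_abs)
    (ler_normD2 _ _ _ _ _ (ler_normD2 _ _ _ _ _
      (ler_normM2 _ _ _ _ _ tv thg) (ler_normM2 _ _ _ _ _ tg thv))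
      (ler_normM2 _ _ _ _ _ th tgv))))
  (ler_normM2 _ _ _ _ _ (ler_normM2 _ _ _ _ _
    (ler_normM2 _ _ _ _ _ s_abs sp_abs) s2p_abs)
    (ler_normM2 _ _ _ _ _ (ler_normM2 _ _ _ _ _ th tg) tv)).
by apply: (le_trans H); rewrite le_eqVlt; apply/orP; left; apply/eqP; field.
Qed.

End bounds.

(** * Membership in the Zolotarev class *)

Section forms.
Context {R : realType} {B : normedModType R}.

Lemma cmlform_sumE k (I : Type) (l : seq I) (c : I -> R) (E : I -> cmlform B k) h :
  (\sum_(i <- l) c i *: E i : cmlform B k) h = \sum_(i <- l) c i * E i h.
Proof.
elim: l => [|i l IHl]; first by rewrite !big_nil.
by rewrite !big_cons -IHl.
Qed.

Lemma is_diff_cmlform_sum k (I : Type) (l : seq I) (c dc : I -> B -> R)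
    (E : I -> cmlform B k) (x : B) : (forall i, is_diff x (c i) (dc i)) ->
  is_diff x (fun y => \sum_(i <- l) c i y *: E i)
    (fun v => \sum_(i <- l) dc i v *: E i).
Proof.
move=> cE.
have H i : is_diff x (fun y => c i y *: E i) (fun v => dc i v *: E i).
  have dci := @ex_diff _ _ _ _ _ _ _ (cE i).
  apply: DiffDef; first exact: differentiableZl.
  by rewrite diffZl// (@diff_val _ _ _ _ _ _ _ (cE i)).
have sE := is_diff_sum R B (cmlform B k) _ l _ _ x H.
have -> : (fun y => \sum_(i <- l) c i y *: E i) = \sum_(i <- l) (fun y => c i y *: E i).
  by apply/funext => y; rewrite fct_sumE.
apply: is_diff_eq sE _; apply/funext => v; by rewrite fct_sumE.
Qed.

Lemma cmlform_norm_le k (g : cmlform B k) M :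
  (forall h, (forall i, `|h i| <= 1) -> `|g h| <= M) -> `|g| <= M.
Proof.
move=> gM; apply: sup_norm_le => [|h h1]; last exact: gM.
by exists (fun=> 0) => i; rewrite normr0.
Qed.

Lemma zolotarev_class_of_holder (s C : R) (f : B -> R)
    (D : forall k : nat, B -> cmlform B k) (m := zolotarev_order s) : 0 < C ->
  frechet_derivatives m f D -> continuous (D m) ->
  (forall x y h, (forall i, `|h i| <= 1) ->
    `|D m x h - D m y h| <= C * `|x - y| `^ holder_exponent s) ->
  @zolotarev_class R B s (fun x => C^-1 * f x).
Proof.
move=> C0 [D0 Dd] Dc Dh; exists (fun k x => C^-1 *: D k x); split.
- split=> [x h|k km x]; first by rewrite -(D0 x h).
  have [dx dE] := Dd k km x.
  have H := is_diffZ C^-1 (differentiableP dx).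
  split; first exact: (@ex_diff _ _ _ _ _ _ _ H).
  by move=> v h; rewrite (@diff_val _ _ _ _ _ _ _ H);
    exact: (congr1 ( *%R C^-1) (dE v h)).
- by move=> x; apply: cvgZr; exact: Dc.
- move=> x y; rewrite -scalerBr normrZ gtr0_norm ?invr_gt0//.
  rewrite ler_pdivrMl//; apply: cmlform_norm_le => h h1; exact: Dh.
Qed.

End forms.

Section products.
Context {R : realType} {B : normedModType R} {N : nat}.
Variable e : 'I_N -> {linear B -> R^o}.
Hypothesis e_le : forall j x, `|e j x| <= `|x|.

(** The derivatives of a function of finitely many coordinates are combinations of these monomials.
    Only the scalar coefficients depend on x, so differentiability in the norm of [cmlform] reduces
    to that of real functions. *)
Definition product_form_fun k (j : 'I_k -> 'I_N) (h : 'I_k -> B) : R^o :=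
  \prod_i (e (j i) (h i) : R).

Lemma continuous_product_coord k (j : 'I_k -> 'I_N) (l : seq 'I_k) :
  continuous ((fun h : 'I_k -> B => \prod_(i <- l) (e (j i) (h i) : R)) :
    {ptws 'I_k -> B} -> R^o).
Proof.
pose f l : {ptws 'I_k -> B} -> R^o := fun h => \prod_(i <- l) (e (j i) (h i) : R).
rewrite -/(f l); elim: l => [|i l IHl].
  have -> : f [::] = cst 1 by apply/funext => h; rewrite /f big_nil.
  exact: cst_continuous.
pose f1 (h : {ptws 'I_k -> B}) : R^o := e (j i) (h i).
have -> : f (i :: l) = (fun h => (f1 h : R) * (f l h : R)).
  by apply/funext => h; rewrite /f big_cons.
move=> h.
have c1 : f1 @ nbhs h --> f1 h.
  have ec : {for h i, continuous (e (j i) : B -> R)}.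
    apply: differentiable_continuous.
    exact: (@ex_diff _ _ _ _ _ _ _ (is_diff_coord e e_le (j i) (h i))).
  have pc := @proj_continuous 'I_k (fun=> B) i h.
  exact: (@cvg_comp _ _ _ (fun g : {ptws 'I_k -> B} => g i) (e (j i) : B -> R)
    _ _ _ pc ec).
exact: (@cvgM R {ptws 'I_k -> B} (nbhs h) _ f1 (f l) _ _ c1 (IHl h)).
Qed.

Lemma product_form_subproof k (j : 'I_k -> 'I_N) :
  product_form_fun k j \in (cmlform_pred : {pred (('I_k -> B) -> R^o)}).
Proof.
apply/asboolP; split.
  move=> i h a u v; rewrite /product_form_fun /= !(bigD1 (P := xpredT) i)//=.
  rewrite !dfwithin linearP.
  have E w : \prod_(l < k | l != i) (e (j l) (dfwith h i w l) : R) =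
      \prod_(l < k | l != i) (e (j l) (h l) : R).
    by apply: eq_bigr => l li; rewrite dfwithout// eq_sym.
  by rewrite !E [LHS]mulrDl -[X in X + _]mulrA.
exact: continuous_product_coord.
Qed.

Definition product_form k (j : 'I_k -> 'I_N) : cmlform B k :=
  MkCmlform (product_form_subproof k j).

End products.

Lemma zolotarev_order_cases (R : realType) (s : R) : 0 < s -> s <= 3 ->
  let m := zolotarev_order s in
  (m <= 2)%N /\ 0 < holder_exponent s <= 1.
Proof.
move=> s0 s3 m; rewrite /holder_exponent -/m.
have c1 : 1 <= Num.ceil s by rewrite -gtz0_ge1 ceil_gt0.
have c3 : Num.ceil s <= 3 by rewrite ceil_le_int.
have mE : m%:Z = Num.ceil s - 1 by rewrite /m /zolotarev_order gez0_abs// subr_ge0.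
have mR : m%:R = (Num.ceil s)%:~R - 1 :> R.
  by rewrite -[m%:R]/(m%:Z%:~R) mE intrB.
have := ceil_itv s => /andP[cl cr]; split.
  by rewrite -lez_nat mE lerBlDr.
by rewrite mR; move: cl cr; rewrite intrB; lra.
Qed.

Section gauge_class.
Context {R : realType} {B : normedModType R} {N : nat}.
Variable e : 'I_N -> {linear B -> R^o}.
Hypothesis e_le : forall j x, `|e j x| <= `|x|.
Variables (k : nat) (K s : R).
Hypotheses (k_even : ~~ odd k) (K_gt0 : 0 < K) (s_gt0 : 0 < s) (s_le3 : s <= 3).
Hypothesis N_le : N%:R <= 2 ^+ k.+4 :> R.

Local Notation p := (k.+4%:R : R).
Local Notation F0 := (smooth_norm e k K s).
Local Notation F1 := (smooth_norm_d1 e k K s).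
Local Notation F2 := (smooth_norm_d2 e k K s).
Local Notation F3 := (smooth_norm_d3 e k K s).
Local Notation E := (product_form e e_le).

Let dlt (j : 'I_N) : 'I_N -> R := fun l => (l == j)%:R.

Let power_sum_dlt i x (h : 'I_N -> R) :
  power_sum e i x h = \sum_j power_sum e i x (dlt j) * h j.
Proof.
apply: eq_bigr => j _; congr (_ * _); rewrite /power_sum (bigD1 j)//= /dlt eqxx.
rewrite mulr1 big1 ?addr0// => l lj.
by rewrite (negbTE lj) mulr0.
Qed.

Let F1_dlt x h : F1 x h = \sum_j F1 x (dlt j) * h j.
Proof.
rewrite /smooth_norm_d1 power_sum_dlt !mulr_sumr; apply: eq_bigr => j _; ring.
Qed.

Let F2_dlt x h g : F2 x h g = \sum_j F2 x (dlt j) g * h j.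
Proof.
rewrite /smooth_norm_d2 power_sum_dlt (power_sum_dlt _ x h) mulr_suml
  !mulr_sumr -big_split/=.
apply: eq_bigr => j _.
have -> : power_sum e k.+2 x (fun l => dlt j l * g l) =
    power_sum e k.+2 x (dlt j) * g j.
  rewrite /power_sum mulr_suml; apply: eq_bigr => l _.
  by rewrite /dlt; have [->|_] := eqVneq l j;
    rewrite /= ?mul0r ?mulr0 ?mul0r// mul1r mulr1.
ring.
Qed.

Let F2C x h g : F2 x h g = F2 x g h.
Proof.
rewrite /smooth_norm_d2 (_ : (fun j => h j * g j) = (fun j => g j * h j));
  first by ring.
by apply/funext => j; rewrite mulrC.
Qed.

(** The coefficients are partial derivatives, that is, values at the unit coordinate vectors
    [dlt j]; in order 0 the form is an empty product. Orders above 2 get the dummy value 0, as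
    [frechet_derivatives] asks nothing beyond m <= 2. *)
Definition gauge_D (i : nat) : B -> cmlform B i :=
  match i return B -> cmlform B i with
  | 0%N => fun x => F0 x *: E _ (fun i : 'I_0 => False_rect _ (notF (ltn_ord i)))
  | 1%N => fun x => \sum_j F1 x (dlt j) *: E _ (fun=> j)
  | 2%N => fun x => \sum_(jl : 'I_N * 'I_N)
      F2 x (dlt jl.1) (dlt jl.2) *: E _ (ord_cons jl.1 (fun=> jl.2))
  | _ => fun=> 0
  end.

Let gauge_D0E x h : gauge_D 0 x h = F0 x.
Proof.
rewrite /gauge_D -[LHS]/(F0 x * product_form_fun e _ _ h) /product_form_fun.
by rewrite big_ord0 mulr1.
Qed.

Let gauge_D1E x h : gauge_D 1 x h = F1 x (fun j => e j (h ord0)).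
Proof.
rewrite /gauge_D cmlform_sumE F1_dlt; apply: eq_bigr => j _; congr (_ * _).
by rewrite -[LHS]/(product_form_fun e _ _ h) /product_form_fun big_ord1.
Qed.

Let gauge_D2E x h : gauge_D 2 x h =
  F2 x (fun j => e j (h ord0)) (fun j => e j (h (lift ord0 ord0))).
Proof.
rewrite /gauge_D cmlform_sumE F2_dlt.
(* [F2_dlt] expands the first slot only; symmetry brings the second one to the front. *)
under [RHS]eq_bigr => j _ do rewrite F2C F2_dlt mulr_suml.
rewrite pair_bigA/=; apply: eq_bigr => -[j l] _ /=.
rewrite F2C -mulrA; congr (_ * _).
rewrite -[LHS]/(product_form_fun e _ _ h) /product_form_fun big_ord_recl big_ord1.
by rewrite /ord_cons unlift_none liftK mulrC.
Qed.

Let is_diff_gauge_D1 x : is_diff x (gauge_D 1)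
  (fun v => \sum_j F2 x (dlt j) (fun l => e l v) *: E _ (fun=> j)).
Proof.
apply: is_diff_cmlform_sum => j; exact: is_diff_smooth_norm_d1.
Qed.

Lemma gauge_frechet_derivatives m : (m <= 2)%N ->
  frechet_derivatives m F0 gauge_D.
Proof.
move=> m2; split; first exact: gauge_D0E.
move=> [|[|i]] im x.
- have cE := is_diff_smooth_norm e e_le k K s k_even K_gt0 x.
  have dc := @ex_diff _ _ _ _ _ _ _ cE.
  split; first exact: differentiableZl.
  move=> v h; rewrite /gauge_D diffZl// (@diff_val _ _ _ _ _ _ _ cE).
  rewrite gauge_D1E -[LHS]/(F1 x _ * product_form_fun e _ _ h) /product_form_fun.
  by rewrite big_ord0 mulr1 /ord_cons unlift_none.
- have cE := is_diff_gauge_D1 x.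
  split; first exact: (@ex_diff _ _ _ _ _ _ _ cE).
  move=> v h; rewrite (@diff_val _ _ _ _ _ _ _ cE) gauge_D2E cmlform_sumE F2C F2_dlt.
  rewrite /ord_cons unlift_none liftK; apply: eq_bigr => j _; congr (_ * _).
  by rewrite -[LHS]/(product_form_fun e _ _ h) /product_form_fun big_ord1.
- by have := leq_trans im m2.
Qed.

Lemma gauge_D_continuous m : (m <= 2)%N -> continuous (gauge_D m).
Proof.
have d0 x : differentiable (gauge_D 0) x.
  apply: differentiableZl.
  exact: (@ex_diff _ _ _ _ _ _ _ (is_diff_smooth_norm e e_le k K s k_even K_gt0 x)).
have d1 x : differentiable (gauge_D 1) x.
  exact: (@ex_diff _ _ _ _ _ _ _ (is_diff_gauge_D1 x)).
have d2 x : differentiable (gauge_D 2) x.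
  have H (jl : 'I_N * 'I_N) :=
    is_diff_smooth_norm_d2 e e_le k K s k_even K_gt0 x (dlt jl.1) (dlt jl.2).
  exact: (@ex_diff _ _ _ _ _ _ _ (is_diff_cmlform_sum _ _ _ _ _ _ x H)).
case: m => [|[|[|//]]] _ x.
- exact: (differentiable_continuous (d0 x)).
- exact: (differentiable_continuous (d1 x)).
- exact: (differentiable_continuous (d2 x)).
Qed.

Let W := gauge_root e k K.

Let W_gt0 x : 0 < W x. Proof. exact: gauge_root_gt0. Qed.

Let W_powRB x i : W x `^ s / W x ^+ i = W x `^ (s - i%:R).
Proof.
rewrite powRB; last by rewrite (gt_eqF (W_gt0 x)) implybT.
by rewrite powR_mulrn// ltW.
Qed.

(** For a fixed unit [h] this concerns a real function, so [holder_of_growth] applies with exponent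
    s - m. Its two growth hypotheses are the bounds on the derivatives of orders m and m + 1; the
    latter, of size p^m, determines the constant, and 720 covers all three cases. *)
Lemma gauge_D_holder (m := zolotarev_order s) x y h : (forall i, `|h i| <= 1) ->
  `|gauge_D m x h - gauge_D m y h| <=
    16 * (720 * p ^+ m) * `|x - y| `^ holder_exponent s.
Proof.
have [m2 a01] := zolotarev_order_cases _ s s_gt0 s_le3.
have lip := gauge_root_lipschitz e e_le k K k_even K_gt0 N_le.
have p1 : 1 <= p by rewrite ler1n.
have A0 i : 0 <= 720 * p ^+ i by rewrite mulr_ge0 ?ler0n ?exprn_ge0 ?ler0n.
rewrite /holder_exponent -/m in m2 a01 *; move: a01 h;
  move: (m) m2 => [|[|[|//]]] _ a01 h h1.
- have -> : gauge_D 0 x h - gauge_D 0 y h = F0 x - F0 y.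
    by congr (_ - _); exact: gauge_D0E.
  have dF0 := is_diff_smooth_norm e e_le k K s k_even K_gt0.
  apply: (holder_of_growth _ _ W F0 _ _ _ a01 (A0 0%N) W_gt0 lip dF0) => [z|z v].
    rewrite expr0 mulr1 subr0 smooth_normE.
    rewrite ger0_norm ?powR_ge0//.
    by rewrite ler_peMl ?powR_ge0 ?ler1n.
  have /le_trans := smooth_norm_d1_le e k K s k_even K_gt0 s_gt0 s_le3 N_le z _ _
    (normr_ge0 v) (fun j => e_le j v); apply.
  rewrite -/W -[X in _ / X]expr1 W_powRB subr0 expr0 mulr1 [X in X <= _]mulrAC.
  by rewrite !ler_wpM2r ?powR_ge0 ?normr_ge0 ?ler_nat.
- have h0 j : `|e j (h ord0)| <= 1 by rewrite (le_trans (e_le _ _)).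
  rewrite !gauge_D1E; apply: (holder_of_growth _ _ W _ _ _ _ a01 (A0 1%N) W_gt0 lip
    (fun z => is_diff_smooth_norm_d1 e e_le k K s k_even K_gt0 z _)) => [z|z v].
    have /le_trans := smooth_norm_d1_le e k K s k_even K_gt0 s_gt0 s_le3 N_le z
      _ _ ler01 h0.
    apply; rewrite -/W -[X in _ / X]expr1 W_powRB ler_wpM2r ?powR_ge0//.
    by rewrite expr1; lra.
  have /le_trans := smooth_norm_d2_le e k K s k_even K_gt0 s_gt0 s_le3 N_le z _ _ _ _
    ler01 (normr_ge0 v) h0 (fun j => e_le j v); apply.
  rewrite -/W W_powRB mul1r expr1 [X in X <= _]mulrAC -addrA -opprD.
  rewrite -[1%:R + 1]/(2%:R) ler_wpM2r// ler_wpM2r ?powR_ge0//; lra.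
- have h0 j : `|e j (h ord0)| <= 1 by rewrite (le_trans (e_le _ _)).
  have h1' j : `|e j (h (lift ord0 ord0))| <= 1 by rewrite (le_trans (e_le _ _)).
  rewrite !gauge_D2E; apply: (holder_of_growth _ _ W _ _ _ _ a01 (A0 2%N) W_gt0 lip
    (fun z => is_diff_smooth_norm_d2 e e_le k K s k_even K_gt0 z _ _)) => [z|z v].
    have /le_trans := smooth_norm_d2_le e k K s k_even K_gt0 s_gt0 s_le3 N_le z _ _ _ _
      ler01 ler01 h0 h1'.
    apply; rewrite -/W W_powRB ler_wpM2r ?powR_ge0//.
    by rewrite !mulr1 ler_pM ?ler_nat ?ler0n// expr2 ler_peMl ?ler0n.
  have /le_trans := smooth_norm_d3_le e k K s k_even K_gt0 s_gt0 s_le3 N_le z _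
    _ _ _ _ _
    ler01 ler01 (normr_ge0 v) h0 h1' (fun j => e_le j v); apply.
  rewrite -/W W_powRB !mul1r [X in X <= _]mulrAC -addrA -opprD.
  by rewrite (_ : 2 + 1 = 3 :> R)//; ring.
Qed.

Lemma gauge_zolotarev_class :
  @zolotarev_class R B s
    (fun x => (16 * (720 * p ^+ zolotarev_order s))^-1 * F0 x).
Proof.
have [m2 a01] := zolotarev_order_cases _ s s_gt0 s_le3.
apply: zolotarev_class_of_holder.
- by rewrite !mulr_gt0 ?exprn_gt0 ?ltr0n.
- exact: gauge_frechet_derivatives.
- exact: gauge_D_continuous.
- by move=> x y h h1; exact: gauge_D_holder.
Qed.

End gauge_class.

(** * Size of the test functions *)

Lemma powR_subadditive (R : realType) (a b t : R) : 0 <= a -> 0 <= b ->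
  0 <= t <= 1 -> (a + b) `^ t <= a `^ t + b `^ t.
Proof.
move=> a0 b0 /andP[t0 t1].
have [ab0|ab0] := eqVneq (a + b) 0.
  have a00 : a = 0 by lra.
  by rewrite a00 add0r lerDr powR_ge0.
have abp : 0 < a + b by rewrite lt0r ab0 addr_ge0.
(* A ratio in [0,1] does not decrease when raised to the power t <= 1; the cases c = a and c = b add
   up to the claim. *)
have H c : 0 <= c -> c <= a + b -> c / (a + b) * (a + b) `^ t <= c `^ t.
  move=> c0 cab; have [->|cN0] := eqVneq c 0; first by rewrite !mul0r powR_ge0.
  have cp : 0 < c by rewrite lt0r cN0.
  have c1 : 0 < c / (a + b) <= 1 by rewrite divr_gt0//= ler_pdivrMr// mul1r.
  apply: (le_trans (ler_wpM2r (powR_ge0 _ _) (ger1_powR c1 t1))).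
  by rewrite -powRM ?divfK// ?divr_ge0 ?(ltW abp).
have := lerD (H a a0 _) (H b b0 _); rewrite lerDl lerDr => /(_ b0 a0).
by rewrite -mulrDl -mulrDl divff// mul1r.
Qed.

Section gauge_size.
Context {R : realType} {B : normedModType R} {N : nat}.
Variable e : 'I_N -> {linear B -> R^o}.
Hypothesis e_le : forall j x, `|e j x| <= `|x|.
Variables (k : nat) (K s : R).
Hypotheses (k_even : ~~ odd k) (K_gt0 : 0 < K) (s_gt0 : 0 < s) (s_le3 : s <= 3).
Hypothesis N_le : N%:R <= 2 ^+ k.+4 :> R.

Local Notation p := (k.+4%:R : R).
Local Notation F0 := (smooth_norm e k K s).

Let p_even : ~~ odd k.+4. Proof. by rewrite !oddS !negbK. Qed.

Let powRX a : 0 <= a -> (a ^+ k.+4) `^ (s / p) = a `^ s.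
Proof.
by move=> a0; rewrite -powR_mulrn// -powRrM mulrC divfK// pnatr_eq0.
Qed.

Let expe_ge0 j x : 0 <= e j x ^+ k.+4 * 1.
Proof. by rewrite mulr1 exprn_even_ge0. Qed.

Let sp : 0 <= s / p <= 1.
Proof.
rewrite divr_ge0 ?(ltW s_gt0) ?ler0n//= ler_pdivrMr ?ltr0n// mul1r.
by rewrite (le_trans s_le3)// ler_nat.
Qed.

Lemma smooth_norm_ge_cst x : K `^ s <= F0 x.
Proof.
rewrite -(powRX K (ltW K_gt0)) ge0_ler_powR//; first by case/andP: sp.
- by rewrite nnegrE exprn_ge0// ltW.
- by rewrite nnegrE ltW// gauge_gt0.
- by rewrite lerDl sumr_ge0.
Qed.

Lemma smooth_norm_ge_coord x j : `|e j x| `^ s <= F0 x.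
Proof.
rewrite -powRX// ge0_ler_powR//; first by case/andP: sp.
- by rewrite nnegrE exprn_ge0.
- by rewrite nnegrE ltW// gauge_gt0.
- rewrite -normrX ger0_norm ?exprn_even_ge0//.
  rewrite /gauge /power_sum (bigD1 j)//= mulr1 addrCA lerDl addr_ge0 ?sumr_ge0//.
  by rewrite exprn_ge0// ltW.
Qed.

Let F0_le x M : `|x| <= M -> F0 x <= (K ^+ k.+4 + (2 * M) ^+ k.+4) `^ (s / p).
Proof.
move=> xM; have M0 : 0 <= M by rewrite (le_trans _ xM).
rewrite ge0_ler_powR//; first by case/andP: sp.
- by rewrite nnegrE ltW// gauge_gt0.
- by rewrite nnegrE addr_ge0// exprn_ge0 ?mulr_ge0// ltW.
- rewrite lerD2l exprMn.
  apply: (@le_trans _ _ (\sum_(j < N) M ^+ k.+4)).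
    apply: ler_sum => j _; rewrite mulr1 -[e j x ^+ _]ger0_norm ?exprn_even_ge0//.
    by rewrite normrX lerXn2r ?nnegrE// (le_trans (e_le _ _)).
  by rewrite sumr_const card_ord -[X in X <= _]mulr_natl ler_wpM2r// exprn_ge0.
Qed.

(** As s <= 3 < p, the power s/p is subadditive and splits off K^s. *)
Lemma smooth_norm_sub_le_powR x M : `|x| <= M -> F0 x - K `^ s <= (2 * M) `^ s.
Proof.
move=> xM; have M0 : 0 <= M by rewrite (le_trans _ xM).
have M20 : 0 <= 2 * M by rewrite mulr_ge0.
rewrite lerBlDl (le_trans (F0_le _ _ xM))//.
apply: le_trans (powR_subadditive _ _ _ _ _ _ sp) _;
  rewrite ?exprn_ge0// ?(ltW K_gt0)//.
by rewrite !powRX// ltW.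
Qed.

(** If 2M > K, then (2M)^s <= (2M)^3 <= (2M)^4 / K. Otherwise put v = (2M/K)^p <= (2M/K)^4, using p
    >= 4; then (1 + v)^(s/p) <= 1 + v, and K^s v <= K^3 (2M/K)^4. *)
Lemma smooth_norm_sub_le_inv x M : 1 <= K -> `|x| <= M ->
  F0 x - K `^ s <= (2 * M) ^+ 4 / K.
Proof.
move=> K1 xM; have M0 : 0 <= M by rewrite (le_trans _ xM).
have M20 : 0 <= 2 * M by rewrite mulr_ge0.
have [uK|Ku] := leP (2 * M) K; last first.
  apply: (le_trans (smooth_norm_sub_le_powR _ _ xM)).
  have u1 := le_lt_trans K1 Ku.
  apply: (@le_trans _ _ ((2 * M) `^ 3)); first by rewrite ler_powR// ltW.
  rewrite powR_mulrn// ler_pdivlMr// [X in _ <= X]exprSr.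
  by rewrite ler_wpM2l ?exprn_ge0// ltW.
rewrite lerBlDl (le_trans (F0_le _ _ xM))//.
set u := 2 * M in M20 uK *; pose v := (u / K) ^+ k.+4.
have v0 : 0 <= v by rewrite exprn_ge0// divr_ge0// ltW.
have -> : K ^+ k.+4 + u ^+ k.+4 = K ^+ k.+4 * (1 + v).
  by rewrite mulrDr mulr1 /v -exprMn mulrC divfK// gt_eqF.
rewrite powRM ?exprn_ge0 ?addr_ge0 ?(ltW K_gt0)// powRX ?(ltW K_gt0)//.
apply: (@le_trans _ _ (K `^ s * (1 + v))).
  rewrite ler_wpM2l ?powR_ge0// ler1_powR ?lerDl//; by case/andP: sp.
rewrite mulrDr mulr1 lerD2l.
have vle : v <= (u / K) ^+ 4.
  rewrite /v ler_wiXn2l// ?divr_ge0// ?(ltW K_gt0)//.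
  by rewrite ler_pdivrMr// mul1r.
apply: (@le_trans _ _ (K ^+ 3 * (u / K) ^+ 4)).
  by rewrite ler_pM ?powR_ge0// -powR_mulrn ?(ltW K_gt0)// ler_powR.
rewrite expr_div_n (_ : K ^+ 3 * _ = u ^+ 4 / K)//; field.
by rewrite gt_eqF.
Qed.

End gauge_size.

(** * Uniform integrability from the test functions *)

Section integrals.
Context {R : realType} {d : measure_display} {T : measurableType d}.
Variable mu : {measure set T -> \bar R}.

(* No measurability is needed since the integral of a nonnegative function is
   defined as a supremum over the simple functions below it. *)
Lemma lower_integral_le (f g : T -> \bar R) :
  (forall x, 0 <= f x)%E -> (forall x, f x <= g x)%E ->
  (\int[mu]_x f x <= \int[mu]_x g x)%E.
Proof.
move=> f0 fg; have g0 x : (0 <= g x)%E := le_trans (f0 x) (fg x).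
rewrite !ge0_integralTE//; apply: le_ereal_sup => _ [h hf <-].
by exists h => // x; exact: le_trans (hf x) (fg x).
Qed.

Lemma integral_small (f : nat -> T -> R) (g : T -> R) (eps : R) :
  (forall n, measurable_fun setT (f n)) ->
  mu.-integrable setT (EFin \o g) ->
  (forall n x, 0 <= f n x <= g x) ->
  (forall x, f n x @[n --> \oo] --> 0) -> 0 < eps ->
  \forall n \near \oo, (\int[mu]_x (f n x)%:E <= eps%:E)%E.
Proof.
move=> mf ig fg f0 eps0.
have H : (\int[mu]_x (f n x)%:E)%E @[n --> \oo] --> 0%:E.
  have [] := @dominated_convergence _ T R mu setT measurableT
    (fun n => EFin \o f n) (cst 0%E) (EFin \o g) _ _ _ ig _ => //.
  - by move=> n; apply/measurable_EFinP.
  - apply: aeW => x _; apply: cvg_EFin; last exact: f0.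
    by apply: nearW.
  - apply: aeW => x n _ /=; rewrite lee_fin.
    by have /andP[f0' fg'] := fg n x; rewrite ger0_norm.
  - by move=> _ _; rewrite integral0.
have /fine_cvgP[Hfin /cvgrPdist_le/(_ _ eps0) Hle] := H.
near=> n; rewrite -(@fineK _ (\int[mu]_x _)%E); last by near: n.
rewrite lee_fin; apply: le_trans (ler_norm _) _.
by rewrite -normrN -[X in `|X|]sub0r; near: n.
Unshelve. all: by end_near. Qed.

Lemma integral_tail_small (f : T -> R) (eps : R) : (forall x, 0 <= f x) ->
  mu.-integrable setT (EFin \o f) -> 0 < eps ->
  exists M : R, forall K, M <= K ->
    (\int[mu]_(x in [set x | (K < `|f x|)%R]) `|f x|%R%:E <= eps%:E)%E.
Proof.
move=> f0 if_ eps0.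
have mf : measurable_fun setT f by apply/measurable_EFinP; case/integrableP: if_.
pose g (n : nat) x := if n%:R < f x then f x else 0.
have [] : \forall n \near \oo, (\int[mu]_x (g n x)%:E <= eps%:E)%E.
  apply: (integral_small _ f) => //.
  - move=> n; apply: measurable_fun_ifT => //.
    by apply: measurable_fun_ltr => //; exact: measurable_cst.
  - by move=> n x; rewrite /g; case: ifP; rewrite ?lexx ?f0.
  - move=> x; apply: cvg_near_cst; near=> n; rewrite /g ltNge.
    by rewrite (_ : _ <= _) //; near: n; exact: nbhs_infty_ger.
move=> M _ /(_ M (leqnn M)) HM; exists M%:R => K MK.
rewrite integral_mkcond; apply: le_trans HM; apply: lower_integral_le => x.
  by rewrite patchE; case: ifP.
rewrite patchE /g; case: ifPn => [|_].
  by rewrite inE/= ger0_norm// => Kf; rewrite (le_lt_trans MK).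
by case: ifP; rewrite lee_fin.
Unshelve. all: by end_near. Qed.

End integrals.

Section uniform_integrability.
Context {R : realType} {d : measure_display} {T : measurableType d}.
Variable P : probability T R.

(** The finitely many indices below [n0] are integrable one by one; a threshold above the sum of
    their individual thresholds serves them all. *)
Lemma uniformly_integrable_of_tails (F : nat -> T -> R) :
  (forall n x, 0 <= F n x) ->
  (forall n, P.-integrable setT (EFin \o F n)) ->
  (forall eps, 0 < eps -> exists (M : R) (n0 : nat), forall n K, (n0 <= n)%N ->
    M <= K ->
    (\int[P]_(x in [set x | (K < `|F n x|)%R]) `|F n x|%R%:E <= eps%:E)%E) ->
  uniformly_integrable P F.
Proof.
move=> F0 iF HF; rewrite /uniformly_integrable.
set u := (fun K => _).
have u0 K : (0 <= u K)%E.
  apply: le_trans (ereal_sup_ubound _); last by exists 0%N.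
  exact: integral_ge0.
have small eps : 0 < eps -> \forall K \near +oo, (u K <= eps%:E)%E.
  move=> eps0; have [M [n0 HM]] := HF eps eps0.
  have /choice[N HN] : forall n, exists N : R, forall K, N <= K ->
      (\int[P]_(x in [set x | (K < `|F n x|)%R]) `|F n x|%R%:E <= eps%:E)%E.
    by move=> n; exact: integral_tail_small.
  near=> K; apply: ge_ereal_sup => _ [n _ <-].
  have [nn0|nn0] := leqP n0 n.
    by apply: HM => //; near: K; apply: nbhs_pinfty_ge; rewrite num_real.
  apply: HN; apply: (@le_trans _ _ (\sum_(i < n0) `|N i|)).
    rewrite (bigD1 (Ordinal nn0))//= (le_trans (ler_norm _))// lerDl sumr_ge0//.
  by near: K; apply: nbhs_pinfty_ge; rewrite num_real.
apply/fine_cvgP; split.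
  near=> K; rewrite ge0_fin_numE//.
  apply: (@le_lt_trans _ _ 1%:E); last exact: ltry.
  by near: K; exact: small.
apply/cvgrPdist_le => eps eps0; near=> K; rewrite sub0r normrN ger0_norm ?fine_ge0//=.
have uK : (u K <= eps%:E)%E by near: K; exact: small.
by rewrite -lee_fin fineK// ge0_fin_numE// (le_lt_trans uK)// ltry.
Unshelve. all: by end_near. Qed.

End uniform_integrability.

Lemma integral_le_of_diff (R : realType) (d : measure_display)
    (T : measurableType d) (mu : {measure set T -> \bar R}) (a b : T -> R) (C : R)
    (z : \bar R) : 0 < C ->
  mu.-integrable setT (EFin \o a) -> mu.-integrable setT (EFin \o b) ->
  (`|\int[mu]_w (C^-1 * (a w - b w))%:E| <= z)%E ->
  (\int[mu]_w (a w)%:E <= \int[mu]_w (b w)%:E + C%:E * z)%E.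
Proof.
move=> C0 ia ib.
have fa := integrable_fin_num measurableT ia.
have fb := integrable_fin_num measurableT ib.
have -> : (\int[mu]_w (C^-1 * (a w - b w))%:E =
    C^-1%:E * (\int[mu]_w (a w)%:E - \int[mu]_w (b w)%:E))%E.
  have /= <- := integralB measurableT ia ib.
  have /= <- := integralZl measurableT (integrableB measurableT ia ib) C^-1.
  by apply: eq_integral => w _; rewrite /= -EFinB -EFinM.
move=> zeta; rewrite -leeBlDl//.
have := le_trans (lee_abs _) zeta.
rewrite -(@lee_pmul2l _ C%:E)// ?lte_fin//.
by rewrite muleA -EFinM divff ?gt_eqF// mul1e.
Qed.

Section expectation_bound.
Context {R : realType} {B : normedModType R} {N : nat}.
Variable e : 'I_N -> {linear B -> R^o}.
Hypothesis e_le : forall j x, `|e j x| <= `|x|.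
Variables (k : nat) (K s : R).
Hypotheses (k_even : ~~ odd k) (K_ge1 : 1 <= K) (s_gt0 : 0 < s) (s_le3 : s <= 3).
Hypothesis N_le : N%:R <= 2 ^+ k.+4 :> R.
Context {d : measure_display} {T : measurableType d} (P : probability T R).

Local Notation F0 := (smooth_norm e k K s).

Let K_gt0 : 0 < K. Proof. exact: lt_le_trans ltr01 K_ge1. Qed.

Lemma measurable_smooth_norm (X : T -> B) :
  (forall j, measurable_fun setT (fun w => e j (X w) : R)) ->
  measurable_fun setT (fun w => F0 (X w)).
Proof.
move=> mX.
have mG : measurable_fun setT (fun w => gauge e k K (X w)).
  apply: measurable_funD; first exact: measurable_cst.
  apply: measurable_sum => j; apply: measurable_funM; last exact: measurable_cst.
  exact: measurable_funX.
exact: (measurableT_comp (measurable_powR (s / k.+4%:R)) mG).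
Qed.

Lemma integrable_smooth_norm (X : T -> B) (Z : T -> R) :
  (forall j, measurable_fun setT (fun w => e j (X w) : R)) ->
  measurable_fun setT Z -> (forall w, 0 <= Z w) ->
  {ae P, forall w, `|X w| <= Z w} ->
  P.-integrable setT (fun w => (Z w `^ s)%:E) ->
  P.-integrable setT (fun w => (F0 (X w) - K `^ s)%:E).
Proof.
move=> mX mZ Z0 XZ /integrableP[mZs iZ].
have mF : measurable_fun setT (fun w => F0 (X w) - K `^ s).
  apply: measurable_funB; [exact: measurable_smooth_norm|exact: measurable_cst].
have a0 w : 0 <= F0 (X w) - K `^ s.
  by rewrite subr_ge0; exact: smooth_norm_ge_cst.
apply/integrableP; split; first exact/measurable_EFinP.
have I4 : (\int[P]_w (2 `^ s * Z w `^ s)%:E < +oo)%E.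
  under eq_integral do rewrite EFinM.
  rewrite ge0_integralZl_EFin ?powR_ge0//; last first.
    by move=> w _; rewrite lee_fin powR_ge0.
  apply: lte_mul_pinfty; rewrite ?lee_fin ?powR_ge0//.
  apply: le_lt_trans iZ; apply: lower_integral_le => w;
    first by rewrite lee_fin powR_ge0.
  by rewrite /= lee_fin ler_norm.
apply: le_lt_trans I4; apply: ae_ge0_le_integral => //.
- by apply/measurable_EFinP; exact: measurableT_comp.
- by move=> w _; rewrite lee_fin mulr_ge0// powR_ge0.
- apply/measurable_EFinP; apply: measurable_funM; first exact: measurable_cst.
  exact/measurable_EFinP.
- apply: filterS XZ => w XZ _; rewrite /= lee_fin ger0_norm//.
  rewrite -powRM//; exact: smooth_norm_sub_le_powR.
Qed.

(* 16 stems from [holder_of_growth] and 720 from [smooth_norm_d3_le]. *)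
Definition gauge_const : R := 16 * (720 * k.+4%:R ^+ zolotarev_order s).

Lemma gauge_const_gt0 : 0 < gauge_const.
Proof. by rewrite !mulr_gt0 ?exprn_gt0 ?ltr0n. Qed.

(** [V] enters only through its bound [Z], which covers both a fixed limit and a dominated sequence.
    [F] is left abstract because the metric on D[0,1] restricts to measurable test functions. The
    constant K^s cancels in the difference of expectations. *)
Lemma gauge_expectation_le (F : set (B -> R)) (X V : T -> B) (Z : T -> R) :
  F (fun x => gauge_const^-1 * F0 x) ->
  (forall j, measurable_fun setT (fun w => e j (X w) : R)) ->
  (forall j, measurable_fun setT (fun w => e j (V w) : R)) ->
  measurable_fun setT (fun w => `|X w|) ->
  measurable_fun setT Z -> (forall w, 0 <= Z w) ->
  {ae P, forall w, `|V w| <= Z w} ->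
  P.-integrable setT (fun w => (`|X w| `^ s)%:E) ->
  P.-integrable setT (fun w => (Z w `^ s)%:E) ->
  (\int[P]_w (F0 (X w) - K `^ s)%:E <=
   \int[P]_w (Num.min ((2 * Z w) `^ s) ((2 * Z w) ^+ 4 / K))%:E +
   gauge_const%:E * zolotarev_dist P F X V)%E.
Proof.
move: gauge_const gauge_const_gt0 => C C0 FF0 mX mV mnX mZ Z0 VZ iX iZ.
have a0 w : 0 <= F0 (X w) - K `^ s by rewrite subr_ge0; exact: smooth_norm_ge_cst.
have b0 w : 0 <= F0 (V w) - K `^ s by rewrite subr_ge0; exact: smooth_norm_ge_cst.
have ia : P.-integrable setT (fun w => (F0 (X w) - K `^ s)%:E).
  apply: (integrable_smooth_norm X (fun w => `|X w|)) => //.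
  exact: aeW.
have ib : P.-integrable setT (fun w => (F0 (V w) - K `^ s)%:E).
  exact: (integrable_smooth_norm V Z).
have bmin : (\int[P]_w (F0 (V w) - K `^ s)%:E <=
    \int[P]_w (Num.min ((2 * Z w) `^ s) ((2 * Z w) ^+ 4 / K))%:E)%E.
  apply: ae_ge0_le_integral => //.
  - by move=> w _; rewrite lee_fin.
  - by case/integrableP: ib.
  - by move=> w _; rewrite lee_fin le_min powR_ge0 divr_ge0 ?exprn_ge0
    ?mulr_ge0 ?(ltW K_gt0).
  - have m2Z : measurable_fun setT (fun w => 2 * Z w) by exact: measurable_funM.
    apply/measurable_EFinP; apply: measurable_minr.
      exact: (measurableT_comp (measurable_powR s) m2Z).
    by apply: measurable_funM => //; exact: measurable_funX.
  - apply: filterS VZ => w VZ _; rewrite lee_fin le_min smooth_norm_sub_le_powR//=.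
    exact: smooth_norm_sub_le_inv.
have zeta : (`|'E_P[(fun w => C^-1 * F0 (X w) - C^-1 * F0 (V w))%R]|
    <= zolotarev_dist P F X V)%E.
  apply: ereal_sup_ubound; by exists (fun x => C^-1 * F0 x).
have zeta' : (`|\int[P]_w (C^-1 * ((F0 (X w) - K `^ s) - (F0 (V w) - K `^ s)))%:E|
    <= zolotarev_dist P F X V)%E.
  move: zeta; rewrite expectation.unlock; congr (`|_| <= _)%E.
  apply: eq_integral => w _; congr EFin.
  by move: (F0 (X w)) (F0 (V w)) (K `^ s) => x y z; rewrite -mulrBr;
    congr (_ * _); ring.
exact: le_trans (integral_le_of_diff _ _ _ P _ _ _ _ C0 ia ib zeta') (leeD2r _ bmin).
Qed.

End expectation_bound.

(** Neither bound suffices alone: the first is integrable but does not shrink with K, the second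
    tends to 0 pointwise but need not be integrable. *)
Lemma integral_min_small (R : realType) (d : measure_display)
    (T : measurableType d) (mu : {measure set T -> \bar R}) (Z : T -> R)
    (s eps : R) :
  measurable_fun setT Z -> (forall w, 0 <= Z w) ->
  mu.-integrable setT (fun w => (Z w `^ s)%:E) -> 0 < eps ->
  exists2 K : R, 1 <= K &
    (\int[mu]_w (Num.min ((2 * Z w) `^ s) ((2 * Z w) ^+ 4 / K))%:E <= eps%:E)%E.
Proof.
move=> mZ Z0 iZ eps0.
have m2Z : measurable_fun setT (fun w => 2 * Z w) by exact: measurable_funM.
have m2Zs := measurableT_comp (measurable_powR s) m2Z.
have i2Z : mu.-integrable setT (EFin \o (fun w => (2 * Z w) `^ s)).
  have := integrableZl measurableT (2 `^ s) iZ.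
  by apply: eq_integrable => // w _; rewrite /= powRM// EFinM.
have [] : \forall n \near \oo, (\int[mu]_w
    (Num.min ((2 * Z w) `^ s) ((2 * Z w) ^+ 4 / n.+1%:R))%:E <= eps%:E)%E.
  apply: (integral_small mu (fun n w => Num.min ((2 * Z w) `^ s) ((2 * Z w) ^+
    4 / n.+1%:R))
    (fun w => (2 * Z w) `^ s)) => //.
  - move=> n; apply: measurable_minr => //.
    by apply: measurable_funM => //; exact: measurable_funX.
  - move=> n w; rewrite ge_min lexx/= andbT le_min powR_ge0/=.
    by rewrite divr_ge0 ?exprn_ge0 ?mulr_ge0.
  - move=> w; apply: (@squeeze_cvgr _ _ _ _ (cst 0) (fun n => (2 * Z w) ^+ 4 *
    n.+1%:R^-1)).
    + apply: nearW => n /=; rewrite ge_min lexx orbT andbT le_min powR_ge0/=.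
      by rewrite divr_ge0 ?exprn_ge0 ?mulr_ge0.
    + exact: cvg_cst.
    + rewrite -[X in _ --> X](mulr0 ((2 * Z w) ^+ 4)).
      apply: cvgM; [exact: cvg_cst|exact: cvg_harmonic].
move=> n _ /(_ n (leqnn n)) Hn; exists n.+1%:R => //.
by rewrite ler1n.
Qed.

(** * Tail estimates for a sequence of grids *)

Section gauge_uniform_integrability.
Context {R : realType} {B : normedModType R}.
Context {d : measure_display} {T : measurableType d} (P : probability T R).
Variables (s : R) (F : set (B -> R)) (X V : nat -> T -> B) (Z : T -> R).
Variables (L : nat -> R) (c : R) (k : nat -> nat).
Variable e : forall n, 'I_(2 ^ (k n).+4) -> {linear B -> R^o}.
(** [A n] holds the outcomes for which the grid may miss the norm, and [H] is a height below which a
    bounded shift may hide it. In the purely piecewise case they are empty and 0. *)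
Variables (A : nat -> set T) (H : R).
Local Notation F0 n K := (smooth_norm (e n) (k n) K s).
Hypotheses (s_gt0 : 0 < s) (s_le3 : s <= 3).
Hypothesis e_le : forall n j x, `|e n j x| <= `|x|.
Hypothesis k_even : forall n, ~~ odd (k n).
Hypotheses (L_gt0 : forall n, 0 < L n) (c_gt0 : 0 < c).
Hypothesis k_le : forall n, (k n).+4%:R <= c * L n.
Hypothesis FF0 : forall n K, 1 <= K ->
  F (fun x => (gauge_const (k n) s)^-1 * F0 n K x).
Hypothesis mX : forall n j, measurable_fun setT (fun w => e n j (X n w) : R).
Hypothesis mV : forall n j, measurable_fun setT (fun w => e n j (V n w) : R).
Hypothesis mnX : forall n, measurable_fun setT (fun w => `|X n w|).
Hypotheses (mZ : measurable_fun setT Z) (Z_ge0 : forall w, 0 <= Z w).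
Hypothesis VZ : forall n, {ae P, forall w, `|V n w| <= Z w}.
Hypothesis iX : forall n, P.-integrable setT (fun w => (`|X n w| `^ s)%:E).
Hypothesis iZ : P.-integrable setT (fun w => (Z w `^ s)%:E).
Hypothesis zeta_o : ereal_littleo (fun n => zolotarev_dist P F (X n) (V n))
  (fun n => L n ^- zolotarev_order s).
Hypothesis mA : forall n, measurable (A n).
Hypothesis A_o : (\int[P]_(w in A n) (`|X n w| `^ s)%:E)%E @[n --> \oo] --> 0%E.
Hypothesis XA : forall n, {ae P, forall w, ~ A n w -> H < `|X n w| ->
  exists j, `|X n w| <= 4 * `|e n j (X n w)| }.

Let m := zolotarev_order s.

(** Since p <= c L, the growth p^m of the Hölder constant is offset by the rate L^-m; the leftover
    16 * 720 * c^m is divided out beforehand. *)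
Let gauge_const_mul_le (n : nat) (eta : R) : 0 <= eta ->
  gauge_const (k n) s * (eta / (16 * 720 * c ^+ m) * L n ^- m) <= eta.
Proof.
move=> eta0; have pm : (k n).+4%:R ^+ m <= c ^+ m * L n ^+ m.
  by rewrite -exprMn lerXn2r ?nnegrE ?ler0n ?mulr_ge0 ?(ltW c_gt0) ?(ltW (L_gt0 n)).
have cm : 0 < c ^+ m by rewrite exprn_gt0.
have Lm : 0 < L n ^+ m by rewrite exprn_gt0.
rewrite /gauge_const -/m.
rewrite (_ : _ * _ = eta * ((k n).+4%:R ^+ m / (c ^+ m * L n ^+ m))); last first.
  by move: (_ ^+ m) cm (L n ^+ m) Lm => x x0 y y0; field; rewrite !gt_eqF.
by rewrite ler_piMr// ler_pdivrMr ?mul1r ?mulr_gt0.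
Qed.

(** With 4^s <= 64, a coordinate of size |X|/4 makes the test function at least |X|^s / 64, and K^s
    takes away at most half of that. *)
Let gauge_lower (n : nat) (K : R) w : 0 < K -> 128 * K `^ s <= `|X n w| `^ s ->
  (exists j, `|X n w| <= 4 * `|e n j (X n w)|) ->
  `|X n w| `^ s <= 128 * (F0 n K (X n w) - K `^ s).
Proof.
move=> K0 Ks [j Xj].
have H1 := smooth_norm_ge_coord (e n) (k n) K s (k_even n) K0 s_gt0 s_le3 (X n w) j.
have H2 : `|X n w| `^ s <= 64 * `|e n j (X n w)| `^ s.
  apply: (@le_trans _ _ ((4 * `|e n j (X n w)|) `^ s)).
    by rewrite ge0_ler_powR ?nnegrE ?mulr_ge0// ltW.
  rewrite powRM// ler_wpM2r ?powR_ge0//.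
  apply: (@le_trans _ _ (4 `^ 3%:R)); first by rewrite ler_powR ?ler1n.
  by rewrite powR_mulrn//; lra.
by lra.
Qed.

Lemma gauge_uniformly_integrable :
  uniformly_integrable P (fun n w => `|X n w| `^ s).
Proof.
apply: uniformly_integrable_of_tails => [n w|n|eps eps0]; first exact: powR_ge0.
  exact: iX.
(* 257 = 1 + 128 * 2: one [eta] for the set [A n] and, with the factor 128 of [gauge_lower], two for
   the excess of the test function over K^s. *)
pose eta := eps / 257; have eta0 : 0 < eta by rewrite divr_gt0 ?ltr0n.
have [K K1 HK] := integral_min_small _ _ _ P Z s eta mZ Z_ge0 iZ eta0.
have K0 : 0 < K by exact: lt_le_trans ltr01 K1.
have etac0 : 0 < eta / (16 * 720 * c ^+ m).
  apply: divr_gt0; first exact: eta0.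
  apply: mulr_gt0; last exact: exprn_gt0.
  by apply: mulr_gt0; rewrite ltr0n.
have [n1 _ Hn1] := zeta_o _ etac0.
have [n2 _ Hn2] : \forall n \near \oo,
    (\int[P]_(w in A n) (`|X n w| `^ s)%:E <= eta%:E)%E.
  have /fine_cvgP[Afin /cvgrPdist_le/(_ _ eta0) Ale] := A_o.
  near=> n; rewrite -(@fineK _ (\int[P]_(w in _) _)%E); last by near: n.
  rewrite lee_fin; apply: le_trans (ler_norm _) _.
  by rewrite -normrN -[X in `|X|]sub0r; near: n.
have N_le n : (2 ^ (k n).+4)%:R <= 2 ^+ (k n).+4 :> R by rewrite natrX.
have excess n : (n1 <= n)%N ->
    (\int[P]_w (F0 n K (X n w) - K `^ s)%:E <= (2 * eta)%:E)%E.
  move=> n1n.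
  have := gauge_expectation_le (e n) (e_le n) (k n) K s (k_even n) K1 s_gt0 s_le3
    (N_le n) P F (X n) (V n) Z (FF0 n K K1) (mX n) (mV n) (mnX n) mZ Z_ge0 (VZ n)
    (iX n) iZ.
  move=> /le_trans; apply; rewrite mulr_natl mulr2n EFinD; apply: leeD => //.
  have z := le_trans (lee_abs _) (Hn1 n n1n).
  have C0 := gauge_const_gt0 (k n) s.
  apply: le_trans (lee_wpmul2l _ z) _; first by rewrite lee_fin ltW.
  rewrite -EFinM lee_fin ger0_norm ?invr_ge0 ?exprn_ge0 ?(ltW (L_gt0 n))//.
  exact: (gauge_const_mul_le n eta (ltW eta0)).
(* Above this threshold both [H < |X n w|] and the hypothesis of [gauge_lower] hold; [H] may be
   negative, hence its absolute value. *)
exists (`|H| `^ s + 128 * K `^ s), (maxn n1 n2) => n Kt.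
rewrite geq_max => /andP[n1n n2n] KtM.
set f := fun w => `|X n w| `^ s.
have f0 w : 0 <= f w by exact: powR_ge0.
have mEf : measurable_fun setT (EFin \o f) by case/integrableP: (iX n).
have mf : measurable_fun setT f by apply/measurable_EFinP.
pose a w := F0 n K (X n w) - K `^ s.
have a0 w : 0 <= a w.
  by rewrite subr_ge0; exact: (smooth_norm_ge_cst (e n) (k n) K s (k_even n) K0
    s_gt0 s_le3).
have ma : measurable_fun setT a.
  apply: measurable_funB; last exact: measurable_cst.
  exact: (measurable_smooth_norm (e n) (k n) K s).
have mfA : measurable_fun setT ((EFin \o f) \_ (A n)).
  by apply/(measurable_restrictT _ (mA n)).1; exact: measurable_funTS.
have mtail : measurable [set w | Kt < `|f w|].
  rewrite -[X in measurable X]setTI; apply: (measurable_fun_ltr (f := cst Kt)) => //.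
  exact: measurableT_comp.
(* On the tail, |X n|^s is kept as it is on [A n] and replaced by 128 times the excess elsewhere. *)
apply: (@le_trans _ _ (\int[P]_w (((EFin \o f) \_ (A n)) w + (128 * a w)%:E))%E).
  rewrite integral_mkcond; apply: ae_ge0_le_integral => //.
  - by move=> w _; rewrite patchE; case: ifP.
  - apply/(measurable_restrictT _ mtail).1; apply: measurable_funTS.
    by apply/measurable_EFinP; exact: measurableT_comp.
  - move=> w _; rewrite adde_ge0 ?lee_fin ?mulr_ge0 ?ler0n//.
    by rewrite patchE; case: ifP => // _; rewrite /= lee_fin.
  - apply: emeasurable_funD => //; apply/measurable_EFinP; exact: measurable_funM.
  apply: filterS (XA n) => w XAw _; rewrite !patchE.
  have a128 : 0 <= 128 * a w by rewrite mulr_ge0 ?ler0n.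
  case: ifPn => [|_]; last first.
    case: ifPn => _; last by rewrite add0e lee_fin.
    by apply: adde_ge0; rewrite lee_fin.
  rewrite inE/= ger0_norm// => Ktf.
  case: ifPn => [_|]; first by rewrite /= -EFinD lee_fin lerDl.
  rewrite notin_setE add0e lee_fin => Aw; apply: gauge_lower => //.
    have := ltW (le_lt_trans KtM Ktf); apply: le_trans.
    by rewrite lerDr powR_ge0.
  apply: XAw => //; apply: le_lt_trans (ler_norm H) _.
  rewrite ltNge; apply/negP => XH; move: Ktf; rewrite ltNge => /negP; apply.
  apply: le_trans KtM; apply: (@le_trans _ _ (`|H| `^ s)).
    by rewrite ge0_ler_powR ?nnegrE// ltW.
  by rewrite lerDl mulr_ge0 ?powR_ge0.
rewrite ge0_integralD//; last 3 first.
- by move=> w _; rewrite patchE; case: ifP => // _; rewrite /= lee_fin.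
- by move=> w _; rewrite lee_fin mulr_ge0 ?ler0n.
- by apply/measurable_EFinP; exact: measurable_funM.
rewrite -integral_mkcond.
under [X in (_ + X)%E]eq_integral do rewrite EFinM.
rewrite ge0_integralZl_EFin//; last 2 first.
- by move=> w _; rewrite lee_fin.
- exact/measurable_EFinP.
apply: (@le_trans _ _ (eta%:E + 128%:E * (2 * eta)%:E)%E); last first.
  by rewrite -EFinM -EFinD lee_fin le_eqVlt /eta; apply/orP; left; apply/eqP; field.
apply: leeD; first exact: Hn2.
by apply: lee_wpmul2l; [rewrite lee_fin ler0n|exact: excess].
Unshelve. all: by end_near. Qed.

End gauge_uniform_integrability.

(* Off by 4 from the exponent p of the grid 2^-p Z, for the sake of the powers
   p - 1, p - 2, p - 3 in the derivatives. *)
Definition grid_exponent {R : realType} (r : R) : nat :=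
  (Num.trunc (ln (1 / r))).*2.

(** From 1 + x <= e^x at x = -1/2 one gets e <= 4, so 1/r = e^L <= 4^(trunc L + 1). The doubling in
    [grid_exponent] turns powers of 4 into powers of 2, and the shift by 4 leaves a spare factor
    4. *)
Lemma grid_exponent_ge (R : realType) (r : R) : 0 < r < 1 ->
  4 <= r * 2 ^+ (grid_exponent r).+4.
Proof.
move=> /andP[r0 r1]; set L := ln (1 / r).
have e4 : expR 1 <= 4 :> R.
  have h := expR_ge1Dx (- 2^-1 : R).
  have h2 : 2^-1 <= expR (- 2^-1) :> R by lra.
  have -> : expR 1 = expR 2^-1 * expR 2^-1 :> R by rewrite -expRD; congr expR; field.
  rewrite (_ : 4 = 2 * 2)//; last by ring.
  have h3 : expR 2^-1 <= 2 :> R.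
    by rewrite -[X in expR X]opprK expRN -[leRHS]invrK lef_pV2 ?posrE ?expR_gt0
      ?invr_gt0.
  by rewrite ler_pM ?expR_ge0.
have Lq : 1 / r <= 4 ^+ (Num.trunc L).+1.
  rewrite -[1 / r]lnK ?posrE ?divr_gt0// -/L.
  apply: (@le_trans _ _ (expR (Num.trunc L).+1%:R)).
    by rewrite ler_expR ltW// truncnS_gt.
  rewrite -[X in expR X]mulr1 expRM_natl lerXn2r ?nnegrE ?expR_ge0//.
have -> : 2 ^+ (grid_exponent r).+4 = 4 * 4 ^+ (Num.trunc L).+1 :> R.
  rewrite /grid_exponent -/L -exprS -[(_.*2).+4]/((_.+2).*2) -muln2 mulnC exprM.
  by rewrite (_ : 2 ^+ 2 = 4)//; ring.
move: Lq; rewrite ler_pdivrMr// mulrC => Lq.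
by rewrite mulrCA ler_peMr.
Qed.

Lemma grid_exponent_even (R : realType) (r : R) : ~~ odd (grid_exponent r).
Proof. by rewrite /grid_exponent odd_double. Qed.

(** Because sup r_n < 1, log(1/r_n) stays above some l > 0, so the shift by 4 is at most (4/l)
    log(1/r_n). *)
Lemma grid_exponent_le (R : realType) (r : nat -> R) :
  (forall n, 0 < r n < 1) -> sup (range r) < 1 ->
  exists2 c : R, 0 < c &
    forall n, (grid_exponent (r n)).+4%:R <= c * ln (1 / r n).
Proof.
move=> r01 r_sup.
have ubr : has_ubound (range r).
  by exists 1 => _ [n _ <-]; have /andP[_ /ltW] := r01 n.
have rs n : r n <= sup (range r) by apply: ub_le_sup => //; exists n.
have s0 : 0 < sup (range r) by apply: lt_le_trans (rs 0%N); case/andP: (r01 0%N).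
pose l := ln (1 / sup (range r)).
have l0 : 0 < l by rewrite ln_gt0// ltr_pdivlMr// mul1r.
have lL n : l <= ln (1 / r n).
  have /andP[rn0 _] := r01 n.
  by rewrite ler_ln ?posrE ?divr_gt0// !div1r lef_pV2 ?posrE.
exists (2 + 4 / l); first by rewrite addr_gt0 ?divr_gt0.
move=> n; have L0 := lt_le_trans l0 (lL n).
rewrite /grid_exponent -addn4 natrD -muln2 natrM mulrDl; apply: lerD.
  by rewrite mulrC ler_pM2l// truncn_le ltW.
by rewrite mulrAC ler_pdivlMr// ler_pM2l.
Qed.

(** * The three conditions in an abstract function space *)

Section grid_uniform_integrability.
Context {R : realType} {B : normedModType R}.
Context {d : measure_display} {T : measurableType d} (P : probability T R).
Variables (s : R) (r : nat -> R).
Variable ev : forall p : nat, 'I_(2 ^ p) -> {linear B -> R^o}.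
Variables (piecewise : R -> set B) (F : set (B -> R)).
Hypotheses (s_gt0 : 0 < s) (s_le3 : s <= 3).
Hypotheses (r01 : forall n, 0 < r n < 1) (r_sup : sup (range r) < 1).
Hypothesis ev_le : forall p j x, `|ev p j x| <= `|x|.
Hypothesis ev_piecewise : forall (t : R) p x, 0 < t -> 4 <= t * 2 ^+ p ->
  piecewise t x -> exists j, `|x| <= 2 * `|ev p j x|.
Hypothesis FF0 : forall k (K : R), ~~ odd k -> 1 <= K ->
  F (fun x => (gauge_const k s)^-1 * smooth_norm (ev k.+4) k K s x).

(** [B] carries no sigma-algebra here: the one on D[0,1] is not that of the norm. The norm and the
    grid evaluations are all that has to be measurable. *)
Definition grid_measurable (X : T -> B) :=
  (forall p j, measurable_fun setT (fun w => ev p j (X w) : R)) /\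
  measurable_fun setT (fun w => `|X w|).

Lemma snorm_integrable (X : T -> B) : grid_measurable X ->
  (snorm P s X < +oo)%E -> P.-integrable setT (fun w => (`|X w| `^ s)%:E).
Proof.
move=> [_ mX]; have min0 : Num.min s^-1 1 != 0.
  by rewrite gt_eqF// lt_min invr_gt0 s_gt0/=.
move=> /(lty_poweRy min0) Xs; apply/integrableP; split.
  by apply/measurable_EFinP; exact: (measurableT_comp (measurable_powR s) mX).
apply: le_lt_trans Xs; apply: lower_integral_le => w //.
by rewrite /= lee_fin ger0_norm ?powR_ge0.
Qed.

Let L n := ln (1 / r n).

Let L_gt0 n : 0 < L n.
Proof.
have /andP[r0 r1] := r01 n.
by rewrite ln_gt0// ltr_pdivlMr// mul1r.
Qed.

Lemma grid_uniformly_integrable (X V : nat -> T -> B) (Z : T -> B)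
    (A : nat -> set T) (H : R) :
  (forall n, grid_measurable (X n)) -> (forall n, grid_measurable (V n)) ->
  grid_measurable Z ->
  (forall n, (snorm P s (X n) < +oo)%E) -> (snorm P s Z < +oo)%E ->
  (forall n, {ae P, forall w, `|V n w| <= `|Z w| }) ->
  ereal_littleo (fun n => zolotarev_dist P F (X n) (V n))
    (fun n => L n ^- zolotarev_order s) ->
  (forall n, measurable (A n)) ->
  (\int[P]_(w in A n) (`|X n w| `^ s)%:E)%E @[n --> \oo] --> 0%E ->
  (forall n, {ae P, forall w, ~ A n w -> H < `|X n w| ->
    exists j, `|X n w| <= 4 * `|ev (grid_exponent (r n)).+4 j (X n w)| }) ->
  uniformly_integrable P (fun n w => `|X n w| `^ s).
Proof.
move=> mX mV mZ sX sZ VZ zeta mA A0 XA.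
have [c c0 cL] := grid_exponent_le _ r r01 r_sup.
apply: (gauge_uniformly_integrable P s F X V (fun w => `|Z w|) L c
  (fun n => grid_exponent (r n)) (fun n => ev (grid_exponent (r n)).+4) A H) => //.
- by move=> n; exact: grid_exponent_even.
- by move=> n K K1; apply: FF0 => //; exact: grid_exponent_even.
- by move=> n j; have [] := mX n.
- by move=> n j; have [] := mV n.
- by move=> n; have [] := mX n.
- by have [] := mZ.
- by move=> n; exact: (snorm_integrable (X n) (mX n) (sX n)).
- exact: (snorm_integrable Z mZ sZ).
Qed.

(** Covers condition (1), with [V n] and [Z] both equal to the limit, and condition (3), with [V n]
    the dominated sequence. *)
Lemma piecewise_uniformly_integrable (X V : nat -> T -> B) (Z : T -> B) :
  (forall n, grid_measurable (X n)) -> (forall n, grid_measurable (V n)) ->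
  grid_measurable Z ->
  (forall n, (snorm P s (X n) < +oo)%E) -> (snorm P s Z < +oo)%E ->
  (forall n, {ae P, forall w, `|V n w| <= `|Z w| }) ->
  (forall n, {ae P, forall w, piecewise (r n) (X n w)}) ->
  ereal_littleo (fun n => zolotarev_dist P F (X n) (V n))
    (fun n => L n ^- zolotarev_order s) ->
  uniformly_integrable P (fun n w => `|X n w| `^ s).
Proof.
move=> mX mV mZ sX sZ VZ pX zeta.
apply: (grid_uniformly_integrable X V Z (fun=> set0) 0) => //.
  rewrite (_ : (fun n => _) = cst 0%E); first exact: cvg_cst.
  by apply/funext => n; rewrite integral_set0.
move=> n; apply: filterS (pX n) => w pXw _ _.
have [|j Xj] := ev_piecewise _ _ _ _ (grid_exponent_ge _ _ (r01 n)) pXw.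
  by case/andP: (r01 n).
by exists j; rewrite (le_trans Xj)// ler_wpM2r// ler_nat.
Qed.

(* The set of w with Y n w not piecewise linear is not known to be measurable;
   its subset A n, where the grid does not see half of the norm of Y n w, is. *)
Lemma translate_uniformly_integrable (X Y : nat -> T -> B) (V : T -> B)
    (h_ : nat -> B) (h : B) :
  (forall n, grid_measurable (X n)) -> (forall n, grid_measurable (Y n)) ->
  grid_measurable V ->
  (forall n, (snorm P s (X n) < +oo)%E) -> (snorm P s V < +oo)%E ->
  (forall n, {ae P, forall w, X n w = Y n w + h_ n}) ->
  `|h_ n - h| @[n --> \oo] --> (0 : R) ->
  (\int[P]_(w in [set w | ~ piecewise (r n) (Y n w)])
     (`|X n w| `^ s)%:E)%E @[n --> \oo] --> 0%E ->
  ereal_littleo (fun n => zolotarev_dist P F (X n) V)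
    (fun n => L n ^- zolotarev_order s) ->
  uniformly_integrable P (fun n w => `|X n w| `^ s).
Proof.
move=> mX mY mV sX sV XYh hh bad zeta.
have [H Hh] : exists H, forall n, `|h_ n| <= H.
  have /cvg_seq_bounded : cvgn (fun n => `|h_ n - h| : R) by apply/cvg_ex; exists 0.
  move=> [M [_ HM]]; exists (M + 1 + `|h|) => n.
  rewrite -[h_ n](subrK h) (le_trans (ler_normD _ _))// lerD2r.
  have M1 : M < M + 1 by rewrite ltrDl.
  by have := HM _ M1 n I; rewrite /= normr_id.
pose p n := (grid_exponent (r n)).+4.
pose A n := [set w | forall j, 2 * `|ev (p n) j (Y n w)| < `|Y n w|].
have mA n : measurable (A n).
  have -> : A n = \bigcap_(j in [set: 'I_(2 ^ p n)])
      [set w | 2 * `|ev (p n) j (Y n w)| < `|Y n w|].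
    by apply/seteqP; split => w Aw j => [_|]; exact: Aw.
  apply: fin_bigcap_measurable => [|j _]; first exact: finite_finset.
  rewrite -[X in measurable X]setTI.
  have [mYe mYn] := mY n.
  apply: measurable_fun_ltr => //; apply: measurable_funM => //.
  exact: measurableT_comp.
have Abad n : A n `<=` [set w | ~ piecewise (r n) (Y n w)].
  move=> w Aw pw; have [|j] := ev_piecewise _ _ _ _ (grid_exponent_ge _ _ (r01 n)) pw.
    by case/andP: (r01 n).
  by apply/negP; rewrite -ltNge; exact: Aw.
(* The height 6H: for a grid point seeing half of |Y|, |X| <= |Y| + H <= 2 |ev X| + 3H, and 3H < |X|
   / 2 gives |X| <= 4 |ev X|. *)
apply: (grid_uniformly_integrable X (fun=> V) V A (6 * H)) => //.
- by move=> n; exact: aeW.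
- apply: squeeze_cvge (cvg_cst 0%E) bad; apply: nearW => n.
  rewrite integral_ge0/=; last by move=> w _; rewrite lee_fin powR_ge0.
  rewrite integral_mkcond [leRHS]integral_mkcond; apply: lower_integral_le => w.
    by rewrite patchE; case: ifP; rewrite // lee_fin powR_ge0.
  rewrite !patchE; case: ifPn => [/set_mem/Abad wb|_].
    by rewrite mem_set.
  by case: ifP; rewrite // lee_fin powR_ge0.
- move=> n; apply: filterS (XYh n) => w Xw Aw HX.
  have [j Yj] : exists j, `|Y n w| <= 2 * `|ev (p n) j (Y n w)|.
    apply: contrapT => noj; apply: Aw => j; rewrite ltNge; apply/negP => Yj.
    by apply: noj; exists j.
  exists j; have := Hh n; have := ev_le (p n) j (h_ n).
  have : `|X n w| <= `|Y n w| + `|h_ n| by rewrite Xw ler_normD.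
  have : `|ev (p n) j (Y n w)| <= `|ev (p n) j (X n w)| + `|ev (p n) j (h_ n)|.
    rewrite (_ : ev (p n) j (Y n w) = ev (p n) j (X n w) - ev (p n) j (h_ n)).
      exact: ler_normB.
    by rewrite -raddfB Xw addrK.
  lra.
Qed.

End grid_uniform_integrability.

(** * Continuous and cadlag functions *)

Lemma measurable_fun_gt (R : realType) (d : measure_display)
    (T : measurableType d) (f : T -> R) :
  (forall c, measurable [set x | c < f x]) -> measurable_fun setT f.
Proof.
move=> mf _; apply: (measurability _ (RGenOInfty.measurableE R)) => //.
move=> _ [_ [c ->] <-]; rewrite setTI.
have -> : f @^-1` `]c, +oo[ = [set x | c < f x].
  by apply/seteqP; split => x /=; rewrite in_itv/= andbT.
exact: mf.
Qed.

(** * Dyadic grids and partitions of [0,1] *)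

Section grid.
Context {R : realType}.

Lemma grid_point_subproof p (j : 'I_(2 ^ p)) :
  (j%:R / 2 ^+ p : R) \in `[0, 1]%classic.
Proof.
rewrite inE/= in_itv/= divr_ge0 ?exprn_ge0//= ler_pdivrMr ?exprn_gt0// mul1r.
by rewrite -natrX ler_nat ltnW.
Qed.

(** The point 1 is left out, so that right continuity can be used at every grid point to show that
    evaluation there is measurable on D[0,1]. *)
Definition grid_point p (j : 'I_(2 ^ p)) : I01 R :=
  exist (fun x => x \in `[0, 1]%classic) _ (grid_point_subproof p j).

Lemma grid_point_lt1 p (j : 'I_(2 ^ p)) : \val (grid_point p j) < 1.
Proof. by rewrite /= ltr_pdivrMr ?exprn_gt0// mul1r -natrX ltr_nat. Qed.

Lemma grid_point_between p (a : R) : 0 <= a -> a + 2 ^- p <= 1 ->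
  exists j, a <= \val (grid_point p j) < a + 2 ^- p.
Proof.
move=> a0 ap; have p0 : 0 < 2 ^+ p :> R by rewrite exprn_gt0.
have x0 : 0 <= a * 2 ^+ p by rewrite mulr_ge0// ltW.
have := ceil_itv (a * 2 ^+ p); set z := Num.ceil _.
have z0 : 0 <= z by rewrite ceil_ge0 (lt_le_trans _ x0)// ltrN10.
case: z z0 => // n _ /andP[nl nr]; rewrite intrB -pmulrn in nl nr.
have np : (n < 2 ^ p)%N.
  rewrite -(ltr_nat R) natrX.
  have : (a + 2 ^- p) * 2 ^+ p <= 2 ^+ p by rewrite ler_piMl// ltW.
  rewrite mulrDl mulVf ?gt_eqF//; lra.
exists (Ordinal np); rewrite /= ler_pdivlMr// nr/= ltr_pdivrMr//.
by rewrite mulrDl mulVf ?gt_eqF//; lra.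
Qed.

Lemma partition_le (l : nat) (t : nat -> R) i k :
  (forall i, (i < l)%N -> t i < t i.+1) -> (i + k <= l)%N -> t i <= t (i + k)%N.
Proof.
move=> tl; elim: k => [|k IHk] ik; first by rewrite addn0.
rewrite addnS in ik *; apply: le_trans (IHk (ltnW ik)) _.
by rewrite ltW// tl.
Qed.

Lemma partition_mem01 (l : nat) (t : nat -> R) i : t 0%N = 0 -> t l = 1 ->
  (forall i, (i < l)%N -> t i < t i.+1) -> (i <= l)%N -> 0 <= t i <= 1.
Proof.
move=> t0 t1 tl il; rewrite -{1}t0 -t1; apply/andP; split.
  exact: (partition_le l t 0 i tl il).
by have := partition_le l t i (l - i) tl; rewrite subnKC//; exact.
Qed.

Lemma partition_between (l : nat) (t : nat -> R) (u : R) : t 0%N <= u < t l ->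
  exists2 i, (i < l)%N & t i <= u < t i.+1.
Proof.
elim: l => [|l IHl] /andP[t0u utl]; first by have := le_lt_trans t0u utl; rewrite ltxx.
have [tlu|utl'] := leP (t l) u; first by exists l; rewrite ?tlu.
have [|i il H] := IHl; first by rewrite t0u.
by exists i; rewrite // ltnS ltnW.
Qed.

(** Let M be the larger end value, attained at [al] and made nonnegative by a change of sign. The
    total variation is at most 2M, so a quarter of the interval costs at most M/2 and the value at
    [g] is still at least M/2, while no value exceeds M in modulus. *)
Lemma affine_quarter (a b al be u g : R) : al <= u <= be ->
  `|a * be + b| <= `|a * al + b| -> `|g - al| <= (be - al) / 4 ->
  `|a * u + b| <= 2 * `|a * g + b|.
Proof.
move=> /andP[alu ube].
wlog A0 : a b / 0 <= a * al + b => [hw|].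
  have [|A0] := leP 0 (a * al + b); first exact: hw.
  have := hw (- a) (- b); rewrite !mulNr -!opprD !normrN; apply.
  by rewrite oppr_ge0 ltW.
rewrite [X in _ <= X]ger0_norm// ler_norml => /andP[B1 B2] ga.
have slope : `|a| * (be - al) <= 2 * (a * al + b).
  rewrite -[X in _ * X]ger0_norm ?subr_ge0 ?(le_trans alu)// -normrM mulrBr.
  by rewrite ler_norml; lra.
have H1 : `|a * (g - al)| <= (a * al + b) / 2.
  rewrite normrM; apply: le_trans (ler_wpM2l (normr_ge0 a) ga) _; lra.
have H2 : a * u + b <= a * al + b.
  rewrite lerD2r; have [a0|a0] := leP a 0; first by rewrite ler_wnM2l.
  have : a * al <= a * be by rewrite ler_pM2l// (le_trans alu).
  have : a * u <= a * be by rewrite ler_pM2l.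
  lra.
have H3 : - (a * al + b) <= a * u + b.
  have : `|a * (u - al)| <= 2 * (a * al + b).
    rewrite normrM; apply: le_trans slope; apply: ler_wpM2l => //.
    by rewrite ger0_norm ?subr_ge0// lerB.
  rewrite mulrBr ler_norml => /andP[]; lra.
have H4 : `|a * u + b| <= a * al + b by rewrite ler_norml H3.
apply: (le_trans H4); have : (a * al + b) / 2 <= a * g + b.
  by move: H1; rewrite mulrBr ler_norml => /andP[]; lra.
have := ler_norm (a * g + b); lra.
Qed.

(** The grid being finite, a maximising grid point serves all [u] at once, whether or not the
    supremum is attained. *)
Lemma sup_norm_le_grid p (f : I01 R -> R^o) :
  (forall u, exists j, `|f u| <= 2 * `|f (grid_point p j)|) ->
  exists j, sup_norm setT f <= 2 * `|f (grid_point p j)|.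
Proof.
move=> fg; have p0 : (0 < 2 ^ p)%N by rewrite expn_gt0.
have [j _ jmax] := @Order.TotalTheory.arg_maxP _ _ _ (Ordinal p0) xpredT
  (fun j => `|f (grid_point p j)| : R) isT.
exists j; apply: sup_norm_le; first exact: I01_neq0.
move=> u _; have [i ui] := fg u; apply: (le_trans ui).
by rewrite ler_wpM2l//; exact: jmax.
Qed.

End grid.

(** * Evaluations and norm on C[0,1] *)

Section C01.
Context {R : realType}.

Definition C01_eval (t : I01 R) (f : C01 R) : R^o := f t.

Lemma C01_eval_linear t : linear (C01_eval t).
Proof. by []. Qed.

HB.instance Definition _ t := GRing.isLinear.Build R (C01 R) R^o _ (C01_eval t)
  (C01_eval_linear t).

Lemma C01_eval_le t (f : C01 R) : `|C01_eval t f| <= `|f|.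
Proof. exact: (sup_norm_ub (@C01_bounded R f)). Qed.

Definition C01_grid p (j : 'I_(2 ^ p)) : {linear C01 R -> R^o} :=
  C01_eval (grid_point p j).

Lemma C01_grid_piecewise_linear (t : R) p (f : C01 R) : 0 < t ->
  4 <= t * 2 ^+ p -> C01_piecewise_linear t f ->
  exists j, `|f| <= 2 * `|C01_grid p j f|.
Proof.
move=> t0 tp [l [v [v0 v1 vl]]]; apply: sup_norm_le_grid => u.
have vlt i : (i < l)%N -> v i < v i.+1 by move=> /vl[].
have p0 : 0 < 2 ^+ p :> R by rewrite exprn_gt0.
have u01 : 0 <= \val u <= 1 by have := set_valP u; rewrite /= in_itv.
have [i il /andP[iu ui]] : exists2 i, (i < l)%N & v i <= \val u <= v i.+1.
  have /andP[u0 u1] := u01; have [u1'|u1'] := ltP (\val u) 1.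
    have [|i il /andP[iu ui]] := partition_between l v (\val u);
      first by rewrite v0 u0 v1.
    by exists i => //; rewrite iu ltW.
  case: l v1 vlt {vl} => [v1|l v1 vlt]; first by move: v1; rewrite v0 => /eqP;
    rewrite eq_sym oner_eq0.
  exists l => //; rewrite v1 u1 andbT (le_trans _ u1')// -v1 ltW// vlt//.
have [vv tv [a [b fab]]] := vl i il.
have /andP[vi0 _] := partition_mem01 l v i v0 v1 vlt (ltnW il).
have /andP[_ vi1] := partition_mem01 l v i.+1 v0 v1 vlt il.
have mesh : 2 ^- p <= (v i.+1 - v i) / 4.
  rewrite ler_pdivlMr// -[_ * 4]mulrC ler_pdivrMr//; apply: (le_trans tp).
  by rewrite ler_pM2r//; move: tv; rewrite gtr0_norm// subr_gt0.
have p0' : 0 < 2 ^- p :> R by rewrite invr_gt0.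
rewrite fab ?iu//.
have [AB|AB] := leP `|a * v i.+1 + b| `|a * v i + b|.
  have [|j /andP[j1 j2]] := grid_point_between p (v i) vi0.
    by move: vi1 mesh vv; clear; lra.
  exists j; rewrite fab; last by rewrite j1 andTb; move: j2 mesh vv; clear; lra.
  apply: (affine_quarter a b (v i) (v i.+1)) => //; first by rewrite iu.
  by rewrite ger0_norm ?subr_ge0//; move: j2 mesh; clear; lra.
(* Now the right end has the larger value: the grid point is sought just to its left, and
   [affine_quarter] is applied to the reflected function. *)
have [||j /andP[j1 j2]] := grid_point_between p (v i.+1 - 2 ^- p).
- by move: vi0 mesh vv; clear; lra.
- by rewrite subrK.
exists j; rewrite fab; last by apply/andP; split; move: j1 j2 mesh vv; clear; lra.
have := affine_quarter (- a) b (- v i.+1) (- v i) (- \val u) (- \val (grid_point p j)).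
rewrite !mulrNN; apply.
- by rewrite !lerN2 iu ui.
- exact: ltW.
- by rewrite ler_norml; move: j1 j2 mesh p0'; clear; lra.
Qed.

Lemma C01_measurable_open (U : set (C01 R)) : open U -> measurable U.
Proof. by move=> oU; exact: sub_sigma_algebra. Qed.

Lemma C01_measurable_eval t : measurable_fun setT (C01_eval t : C01 R -> R).
Proof.
apply: measurable_fun_gt => c; apply: C01_measurable_open.
have -> : [set f : C01 R | c < (C01_eval t f : R)] = (C01_eval t : C01 R -> R)
  @^-1` [set y | c < y] by [].
apply: open_comp; last exact: open_gt.
move=> f _; apply: differentiable_continuous.
exact: (@ex_diff _ _ _ _ _ _ _
  (is_diff_coord (fun i : 'I_1 => C01_eval t : {linear C01 R -> R^o}) (fun i =>
    C01_eval_le t) ord0 f)).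
Qed.

Lemma C01_measurable_norm : measurable_fun setT (fun f : C01 R => `|f|).
Proof.
apply: measurable_fun_gt => c; apply: C01_measurable_open.
have -> : [set f : C01 R | c < `|f|] = (fun f : C01 R => `|f|) @^-1` [set y | c
  < y] by [].
apply: open_comp; last exact: open_gt.
by move=> f _; exact: norm_continuous.
Qed.

End C01.

(** * Evaluations and norm on D[0,1] *)

Section D01.
Context {R : realType}.

Definition D01_eval (t : I01 R) (f : D01 R) : R^o := f t.

Lemma D01_eval_linear t : linear (D01_eval t).
Proof. by []. Qed.

HB.instance Definition _ t := GRing.isLinear.Build R (D01 R) R^o _ (D01_eval t)
  (D01_eval_linear t).

Lemma D01_eval_le t (f : D01 R) : `|D01_eval t f| <= `|f|.
Proof. exact: (sup_norm_ub (@D01_bounded R f)). Qed.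

Definition D01_grid p (j : 'I_(2 ^ p)) : {linear D01 R -> R^o} :=
  D01_eval (grid_point p j).

Lemma I01_itv (u : I01 R) : 0 <= \val u <= 1.
Proof. by have := set_valP u; rewrite /= in_itv. Qed.

Lemma I01_ex (x : R) : 0 <= x <= 1 -> exists u : I01 R, \val u = x.
Proof.
move=> x01; have h : x \in `[0, 1]%classic by rewrite inE/= in_itv.
by exists (exist (fun x => x \in `[0, 1]%classic) x h).
Qed.

Lemma D01_right_near (f : D01 R) (t : I01 R) (U : set R^o) : nbhs (f t) U ->
  exists2 e : R, 0 < e &
    forall u : I01 R, \val t <= \val u < \val t + e -> U (f u).
Proof.
move=> ftU; have /asboolP/(_ t)[/(_ _ ftU) fr _] := valP f.
have /nbhs_ballP[e /= e0 He] := fr; exists e => // u /andP[tu ue].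
apply: He => //.
suff H : ball (\val t : R) e (\val u) by exact: H.
by rewrite -ball_normE /= distrC ger0_norm ?subr_ge0// ltrBlDl.
Qed.

Lemma skorokhod_distP (f g : D01 R) (e : R) : skorokhod_dist f g < e ->
  exists tau : I01 R -> I01 R,
    forall t, `|f t - g (tau t)| < e /\ `|\val (tau t) - \val t| < e.
Proof.
rewrite /skorokhod_dist; set A := (X in inf X).
(* The identity as time change shows that the infimum is not the default value 0 of an empty set. *)
have A0 : A !=set0.
  exists (`|f| + `|g| + 1); split; first by rewrite ltr_pwDr// addr_ge0.
  exists id; split => // [|t]; first by exists id.
  rewrite subrr normr0; split; last by rewrite ltr_pwDr// addr_ge0.
  rewrite (le_lt_trans (ler_normB _ _))//.
  by rewrite -addrA ler_ltD ?D01_eval_le// ltr_pwDr ?D01_eval_le.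
move=> /(inf_lt A0)[x [_ [tau [_ _ H]]] xe]; exists tau => t.
by have [H1 H2] := H t; rewrite !(lt_trans _ xe).
Qed.

Lemma D01_measurable_open (U : set (D01 R)) : skorokhod_open U -> measurable U.
Proof. by move=> oU; exact: sub_sigma_algebra. Qed.

(** The open time window leaves room for the time change, the strict inequality for the change of
    value; [tau u] is the new witness. *)
Lemma D01_open_exists (a b c : R) :
  skorokhod_open [set f : D01 R | exists2 u : I01 R, a < \val u < b & c < (f u : R)].
Proof.
move=> f [u /andP[au ub] cf].
exists (Num.min (f u - c) (Num.min (\val u - a) (b - \val u))).
  by rewrite !lt_min !subr_gt0 cf au.
move=> g /skorokhod_distP[tau /(_ u)[]]; rewrite !lt_min => /andP[fg _] /and3P[_ ta tb].
exists (tau u).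
  move: ta tb; rewrite !ltr_norml; lra.
move: fg; rewrite ltr_norml; lra.
Qed.

(* By right continuity, f t > c is decided by the suprema of f over ]t, t + 1/n[,
   which are lower semicontinuous for the Skorokhod distance. *)
Lemma D01_measurable_eval (t : I01 R) : \val t < 1 ->
  measurable_fun setT (D01_eval t : D01 R -> R).
Proof.
move=> t1; apply: measurable_fun_gt => c.
have -> : [set f : D01 R | c < (D01_eval t f : R)] =
    \bigcup_k \bigcap_n [set f : D01 R | exists2 u : I01 R,
      \val t < \val u < \val t + n.+1%:R^-1 & c + k.+1%:R^-1 < (f u : R)].
  apply/seteqP; split => f /=.
    rewrite /D01_eval => cf; have d0 : 0 < f t - c by rewrite subr_gt0.
    have [k Hk] : exists k : nat, k.+1%:R^-1 < (f t - c : R).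
      exists (Num.trunc (f t - c)^-1).
      by rewrite -[X in _ < X]invrK ltf_pV2 ?posrE ?invr_gt0// truncnS_gt.
    exists k => // n _; have [|e e0 He] := D01_right_near f t [set y | c +
      k.+1%:R^-1 < y].
      by apply: open_nbhs_nbhs; split; [exact: open_gt|rewrite /= -ltrBrDl].
    (* A point strictly to the right of [t], within reach of right continuity, inside the n-th
       window and still in [0,1]; it exists because t < 1. *)
    pose v := \val t + Num.min (e / 2) (Num.min (n.+1%:R^-1 / 2) (1 - \val t)).
    have n0 : 0 < n.+1%:R^-1 :> R by rewrite invr_gt0.
    have m0 : 0 < Num.min (e / 2) (Num.min (n.+1%:R^-1 / 2) (1 - \val t)).
      by rewrite !lt_min !divr_gt0//= subr_gt0.
    have [m1 m2 m3] : [/\ Num.min (e / 2) (Num.min (n.+1%:R^-1 / 2) (1 - \val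
      t)) <= e / 2,
      Num.min (e / 2) (Num.min (n.+1%:R^-1 / 2) (1 - \val t)) <= n.+1%:R^-1 / 2 &
      Num.min (e / 2) (Num.min (n.+1%:R^-1 / 2) (1 - \val t)) <= 1 - \val t].
      by rewrite !ge_min !lexx ?orbT.
    have /andP[t0 _] := I01_itv t.
    have [u uv] : exists u : I01 R, \val u = v by apply: I01_ex; rewrite /v;
      move: t0 m0 m3; clear; lra.
    have half (x : R) : 0 < x -> x / 2 < x by move=> x0;
      rewrite ltr_pdivrMr// ltr_pMr// ltr1n.
    have v1 : \val t < v by rewrite ltrDl.
    exists u; first by rewrite uv v1 ltrD2l (le_lt_trans m2)// half.
    by apply: He; rewrite uv (ltW v1) ltrD2l (le_lt_trans m1)// half.
  (* Here the margin 1/(k+1) matters: from [f t <= c], right continuity only gives values below c +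
     1/(k+1) on a short window. *)
  move=> [k _ Hk]; rewrite /D01_eval ltNge; apply/negP => fc.
  have k0 : 0 < k.+1%:R^-1 :> R by rewrite invr_gt0.
  have [|e e0 He] := D01_right_near f t [set y | y < c + k.+1%:R^-1].
    by apply: open_nbhs_nbhs; split;
      [exact: open_lt|rewrite /= (le_lt_trans fc)// ltrDl].
  have [u /andP[tu ue] cu] := Hk (Num.trunc e^-1) I.
  have : f u < c + k.+1%:R^-1.
    apply: He; rewrite ltW//= (lt_le_trans ue)// lerD2l.
    by rewrite -[leRHS]invrK lef_pV2 ?posrE ?invr_gt0// ltW// truncnS_gt.
  by rewrite ltNge => /negP; apply; exact: ltW.
apply: bigcup_measurable => k _; apply: bigcapT_measurable => n.
apply: D01_measurable_open; exact: D01_open_exists.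
Qed.

(** A time change does not affect the sup norm, so these superlevel sets are Skorokhod open. *)
Lemma D01_measurable_norm : measurable_fun setT (fun f : D01 R => `|f|).
Proof.
apply: measurable_fun_gt => c; apply: D01_measurable_open => f cf.
have [u cu] : exists u, c < `|f u|.
  apply: contrapT => H; move: cf; rewrite /= ltNge => /negP; apply.
  apply: sup_norm_le => [|u _]; first exact: I01_neq0.
  by rewrite leNgt; apply/negP => cu; apply: H; exists u.
exists (`|f u| - c); first by rewrite subr_gt0.
move=> g /skorokhod_distP[tau /(_ u)[fg _]].
apply: lt_le_trans (D01_eval_le (tau u) g); rewrite /D01_eval.
have : `|f u| <= `|f u - g (tau u)| + `|g (tau u)|.
  by rewrite -{1}[f u](subrK (g (tau u))) ler_normD.
by move: fg; set x := `|f u - _|; set y := `|g _|; set z := `|f u|; lra.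
Qed.

Lemma D01_grid_piecewise_constant (t : R) p (f : D01 R) : 0 < t ->
  4 <= t * 2 ^+ p -> D01_piecewise_constant t f ->
  exists j, `|f| <= 2 * `|D01_grid p j f|.
Proof.
move=> t0 tp [[l [v [v0 v1 vl]]] f1]; apply: sup_norm_le_grid => u.
have vlt i : (i < l)%N -> v i < v i.+1 by move=> /vl[].
have p0 : 0 < 2 ^+ p :> R by rewrite exprn_gt0.
suff piece i c : (i < l)%N ->
    (forall u : I01 R, v i <= \val u < v i.+1 -> f u = c) -> f u = c ->
    exists j, `|f u| <= 2 * `|f (grid_point p j)|.
  have /andP[u0 u1] := I01_itv u; have [u1'|u1'] := ltP (\val u) 1.
    have [|i il iu] := partition_between l v (\val u); first by rewrite v0 u0 v1.
    have [_ _ [c fc]] := vl i il; exact: (piece i c il fc (fc u iu)).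
  (* The end point 1 lies in no half-open piece; continuity there forces [f u] to be the value on
     the last one. *)
  have uE : \val u = 1 by apply/eqP; rewrite eq_le u1.
  case: l v1 vlt vl piece => [v1|l v1 vlt vl piece].
    by move: v1; rewrite v0 => /eqP; rewrite eq_sym oner_eq0.
  have [_ _ [c fc]] := vl l (ltnSn l).
  apply: (piece l c) => //; apply/eqP/negPn/negP => fuc.
  have d0 : 0 < `|f u - c| by rewrite normr_gt0 subr_eq0.
  have /cvgrPdist_lt/(_ _ d0)/nbhs_ballP[e /= e0 He] := f1 u uE.
  have vl1 := vlt l (ltnSn l); rewrite v1 in vl1.
  have /andP[vl0 _] := partition_mem01 l.+1 v l v0 v1 vlt (leqnSn l).
  pose w := Num.max (v l) (1 - e / 2).
  have w1 : w < 1 by rewrite gt_max vl1 ltrBlDl ltrDr divr_gt0.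
  have wl : v l <= w by rewrite le_max lexx.
  have we : 1 - e / 2 <= w by rewrite le_max lexx orbT.
  have [z zw] : exists z : I01 R, \val z = w.
    by apply: I01_ex; rewrite (ltW w1) (le_trans vl0).
  have : `|f u - f z| < `|f u - c|.
    apply: He; suff H : ball (\val u : R) e (\val z) by exact: H.
    rewrite -ball_normE /= uE zw ger0_norm ?subr_ge0 ?(ltW w1)//.
    by move: we e0; clear; lra.
  by rewrite (fc z) ?ltxx// zw wl v1.
move=> il fc fuc; have [vv tv _] := vl i il.
have /andP[vi0 _] := partition_mem01 l v i v0 v1 vlt (ltnW il).
have /andP[_ vi1] := partition_mem01 l v i.+1 v0 v1 vlt il.
have mesh : 2 ^- p <= (v i.+1 - v i) / 4.
  rewrite ler_pdivlMr// -[_ * 4]mulrC ler_pdivrMr//; apply: (le_trans tp).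
  by rewrite ler_pM2r//; move: tv; rewrite gtr0_norm// subr_gt0.
have [|j /andP[j1 j2]] := grid_point_between p (v i) vi0;
  first by move: vi1 mesh vv; clear; lra.
exists j; rewrite (fc (grid_point p j));
  last by rewrite j1/= (lt_le_trans j2)//; move: mesh vv; clear; lra.
(* The grid sees all of |f u| on a constant piece; the factor 2 is that of the piecewise linear
   case. *)
by rewrite fuc ler_peMl// ler1n.
Qed.

End D01.

(** * Application to the two function spaces *)

Lemma C01_gauge_zolotarev_class (R : realType) (s : R) k (K : R) : 0 < s ->
  s <= 3 -> ~~ odd k -> 1 <= K ->
  @zolotarev_class R (C01 R) s
    (fun x => (gauge_const k s)^-1 * smooth_norm (@C01_grid R k.+4) k K s x).
Proof.
move=> s0 s3 ke K1; apply: gauge_zolotarev_class => //.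
- by move=> j x; exact: C01_eval_le.
- exact: lt_le_trans K1.
- by rewrite natrX.
Qed.

Lemma D01_gauge_zolotarev_class (R : realType) (s : R) k (K : R) : 0 < s ->
  s <= 3 -> ~~ odd k -> 1 <= K ->
  (@zolotarev_class R (D01 R) s `&` [set f | measurable_fun [set: D01 R] f])
    (fun x => (gauge_const k s)^-1 * smooth_norm (@D01_grid R k.+4) k K s x).
Proof.
move=> s0 s3 ke K1; split.
  apply: gauge_zolotarev_class => //.
  - by move=> j x; exact: D01_eval_le.
  - exact: lt_le_trans K1.
  - by rewrite natrX.
apply: measurable_funM; first exact: measurable_cst.
(* The space D[0,1] itself, with the identity as random element: measurability of the test function
   reduces to that of the grid evaluations. *)
have := @measurable_smooth_norm R (D01 R) _ (@D01_grid R k.+4) k K s _ (D01 R) id.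
apply => j.
by apply: D01_measurable_eval; exact: grid_point_lt1.
Qed.

Lemma C01_grid_measurable (R : realType) (d : measure_display)
    (T : measurableType d) (P : probability T R) (X : {RV P >-> C01 R}) :
  grid_measurable (@C01_grid R) X.
Proof.
split=> [p j|]; first exact: (measurableT_comp (C01_measurable_eval _)).
exact: (measurableT_comp C01_measurable_norm).
Qed.

Lemma D01_grid_measurable (R : realType) (d : measure_display)
    (T : measurableType d) (P : probability T R) (X : {RV P >-> D01 R}) :
  grid_measurable (@D01_grid R) X.
Proof.
split=> [p j|]; last exact: (measurableT_comp D01_measurable_norm).
exact: (measurableT_comp (D01_measurable_eval _ (grid_point_lt1 _ _))).
Qed.

Theorem theorem12 (R : realType) (d : measure_display) (Omega : measurableType d)
    (P : probability Omega R) (s : R) (r : nat -> R)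
    (s_gt0 : 0 < s) (s_le3 : s <= 3)
    (r01 : forall n, 0 < r n < 1) (r_sup : sup (range r) < 1) :
  (forall (X_ : nat -> {RV P >-> C01 R}) (X : {RV P >-> C01 R}),
     (forall n, (snorm P s (X_ n) < +oo)%E) -> (snorm P s X < +oo)%E ->
     [\/ [/\ forall n, {ae P, forall w, C01_piecewise_linear (r n) (X_ n w)} &
             ereal_littleo (fun n => C01_zeta P s (X_ n) X)
               (fun n => (ln (1 / r n)) ^- zolotarev_order s)],
         exists (Y_ : nat -> {RV P >-> C01 R}) (h_ : nat -> C01 R) (h : C01 R),
           [/\ forall n, {ae P, forall w, X_ n w = Y_ n w + h_ n},
               `|h_ n - h| @[n --> \oo] --> 0,
               (\int[P]_(w in [set w | ~ C01_piecewise_linear (r n) (Y_ n w)])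
                  (`|X_ n w| `^ s)%R%:E)%E @[n --> \oo] --> 0%E &
               ereal_littleo (fun n => C01_zeta P s (X_ n) X)
                 (fun n => (ln (1 / r n)) ^- zolotarev_order s)] |
         exists (Y_ : nat -> {RV P >-> C01 R}) (Z : {RV P >-> C01 R}),
           [/\ {ae P, forall w, forall n t, `|Y_ n w t| <= Z w t},
               (snorm P s Z < +oo)%E,
               forall n, {ae P, forall w, C01_piecewise_linear (r n) (X_ n w)} &
               ereal_littleo (fun n => C01_zeta P s (X_ n) (Y_ n))
                 (fun n => (ln (1 / r n)) ^- zolotarev_order s)]] ->
     uniformly_integrable P (fun n w => `|X_ n w| `^ s)) /\
  (forall (X_ : nat -> {RV P >-> D01 R}) (X : {RV P >-> D01 R}),
     (forall n, (snorm P s (X_ n) < +oo)%E) -> (snorm P s X < +oo)%E ->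
     [\/ [/\ forall n, {ae P, forall w, D01_piecewise_constant (r n) (X_ n w)} &
             ereal_littleo (fun n => D01_zeta P s (X_ n) X)
               (fun n => (ln (1 / r n)) ^- zolotarev_order s)],
         exists (Y_ : nat -> {RV P >-> D01 R}) (h_ : nat -> D01 R) (h : D01 R),
           [/\ continuous (h : I01 R -> R),
               forall n, {ae P, forall w, X_ n w = Y_ n w + h_ n},
               `|h_ n - h| @[n --> \oo] --> 0,
               (\int[P]_(w in [set w | ~ D01_piecewise_constant (r n) (Y_ n w)])
                  (`|X_ n w| `^ s)%R%:E)%E @[n --> \oo] --> 0%E &
               ereal_littleo (fun n => D01_zeta P s (X_ n) X)
                 (fun n => (ln (1 / r n)) ^- zolotarev_order s)] |
         exists (Y_ : nat -> {RV P >-> D01 R}) (Z : {RV P >-> D01 R}),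
           [/\ {ae P, forall w, forall n t, `|Y_ n w t| <= Z w t},
               (snorm P s Z < +oo)%E,
               forall n, {ae P, forall w, D01_piecewise_constant (r n) (X_ n w)} &
               ereal_littleo (fun n => D01_zeta P s (X_ n) (Y_ n))
                 (fun n => (ln (1 / r n)) ^- zolotarev_order s)]] ->
     uniformly_integrable P (fun n w => `|X_ n w| `^ s)).
Proof.
split=> X_ X sX_ sX.
- have mX := @C01_grid_measurable R d Omega P.
  have cls k (K : R) := C01_gauge_zolotarev_class R s k K s_gt0 s_le3.
  have grid_le p j (x : C01 R) : `|@C01_grid R p j x| <= `|x| := C01_eval_le _ x.
  have gridP := @C01_grid_piecewise_linear R.
  case=> [[pX zeta]|[Y_ [h_ [h [XYh hh bad zeta]]]]|[Y_ [Z [YZ sZ pX zeta]]]].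
  + by apply: (piecewise_uniformly_integrable P s r _ _ _ s_gt0 s_le3 r01 r_sup
      grid_le gridP cls X_ (fun=> X) X) => // n; exact: aeW.
  + exact: (translate_uniformly_integrable P s r _ _ _ s_gt0 s_le3 r01 r_sup
      grid_le gridP cls X_ Y_ X h_ h).
  + apply: (piecewise_uniformly_integrable P s r _ _ _ s_gt0 s_le3 r01 r_sup
      grid_le gridP cls X_ Y_ Z) => // n.
    apply: filterS YZ => w YZ; apply: sup_norm_le => [|t _]; first exact: I01_neq0.
    apply: (le_trans (YZ n t)); apply: (le_trans (ler_norm _)).
    exact: C01_eval_le.
- have mX := @D01_grid_measurable R d Omega P.
  have cls k (K : R) := D01_gauge_zolotarev_class R s k K s_gt0 s_le3.
  have grid_le p j (x : D01 R) : `|@D01_grid R p j x| <= `|x| := D01_eval_le _ x.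
  have gridP := @D01_grid_piecewise_constant R.
  case=> [[pX zeta]|[Y_ [h_ [h [_ XYh hh bad zeta]]]]|[Y_ [Z [YZ sZ pX zeta]]]].
  + by apply: (piecewise_uniformly_integrable P s r _ _ _ s_gt0 s_le3 r01 r_sup
      grid_le gridP cls X_ (fun=> X) X) => // n; exact: aeW.
  + exact: (translate_uniformly_integrable P s r _ _ _ s_gt0 s_le3 r01 r_sup
      grid_le gridP cls X_ Y_ X h_ h).
  + apply: (piecewise_uniformly_integrable P s r _ _ _ s_gt0 s_le3 r01 r_sup
      grid_le gridP cls X_ Y_ Z) => // n.
    apply: filterS YZ => w YZ; apply: sup_norm_le => [|t _]; first exact: I01_neq0.
    apply: (le_trans (YZ n t)); apply: (le_trans (ler_norm _)).
    exact: D01_eval_le.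
Qed.
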